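(* Let $K$ be an ample field, let $C$ be a curve defined over $K$ with a simple $K$-rational point, and let $\varphi: C \dashrightarrow C'$ be a separable dominant $K$-rational map to an affine curve $C' \subseteq \mathbb{A}^n$ defined over $K$. Then for every proper subfield $K_0$ of $K$, $$|\varphi(C(K)) \setminus \mathbb{A}^n(K_0)| = |K|.$$
   Context: All varieties are geometrically irreducible and geometrically reduced; a curve is a variety of dimension $1$. A point is called simple if the variety is smooth at that point. A field $K$ is called ample (or large) if every smooth curve defined over $K$ with a $K$-rational point has infinitely many $K$-rational points. A dominant $K$-rational map $\varphi: C \dashrightarrow C'$ of curves is separable if the induced extension of function fields $K(C)|K(C')$ is separable. The set $\varphi(C(K))$ is the set of values $\varphi(P) \in C'(K) \subseteq \mathbb{A}^n(K) = K^n$, where $P$ ranges over the points of $C(K)$ at which $\varphi$ is defined; $\mathbb{A}^n(K_0) = K_0^n \subseteq K^n$. $|X|$ denotes the cardinality of a set $X$. The field $K_0$ is an arbitrary proper subfield of $K$; $C$, $C'$ and $\varphi$ need not be defined over it. *)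

(* Defs.v *)
(* MathComp, with the classical layer of MathComp-Analysis for sets and
   cardinality. *)
From HB Require Import structures.
From mathcomp Require Import all_boot all_order all_algebra all_field.
From mathcomp Require Import mathcomp_extra boolp classical_sets functions.
From mathcomp Require Import cardinality.
From mathcomp Require Import mpoly.

Set Implicit Arguments.
Unset Strict Implicit.
Unset Printing Implicit Defensive.

Import GRing.Theory.

Local Open Scope classical_set_scope.
Local Open Scope ring_scope.

(* A closed subscheme V of affine m-space over K is given by its ideal I in
   K[X_1, ..., X_m].  For a field extension j : K -> L, the base change of V
   to L is given by the ideal of L[X_1, ..., X_m] generated by I. *)
Definition base_change (K L : fieldType) (j : {rmorphism K -> L}) (m : nat)
    (I : {pred {mpoly K[m]}}) : set {mpoly L[m]} :=
  [set g | exists s : seq ({mpoly L[m]} * {mpoly K[m]}),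
     {in s, forall x, x.2 \in I} /\ g = \sum_(x <- s) x.1 * map_mpoly j x.2].

Definition radical (R : nzRingType) (J : set R) : set R :=
  [set g | exists k : nat, J (g ^+ k)].

Definition geom_reduced (K : fieldType) (m : nat)
    (I : {pred {mpoly K[m]}}) : Prop :=
  forall (L : fieldType) (j : {rmorphism K -> L}),
    radical (base_change j I) `<=` base_change j I.

Definition geom_irreducible (K : fieldType) (m : nat)
    (I : {pred {mpoly K[m]}}) : Prop :=
  forall (L : fieldType) (j : {rmorphism K -> L}),
    let J := radical (base_change j I) in
    ~ J 1 /\ (forall f g, J (f * g) -> J f \/ J g).

(* The dimension of V is the transcendence degree over K of its coordinate
   ring K[X_1, ..., X_m] / I. *)
Definition alg_indep_mod (K : fieldType) (m : nat) (I : {pred {mpoly K[m]}})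
    (d : nat) (f : d.-tuple {mpoly K[m]}) : Prop :=
  forall p : {mpoly K[d]}, p \mPo f \in I -> p = 0.

Definition has_dim (K : fieldType) (m : nat) (I : {pred {mpoly K[m]}})
    (d : nat) : Prop :=
  (exists f : d.-tuple {mpoly K[m]}, alg_indep_mod I f) /\
  (forall f : d.+1.-tuple {mpoly K[m]}, ~ alg_indep_mod I f).

(* I is the ideal of an affine curve in affine m-space defined over K. *)
Definition affine_curve (K : fieldType) (m : nat)
    (I : {pred {mpoly K[m]}}) : Prop :=
  [/\ idealr_closed I, geom_irreducible I, geom_reduced I & has_dim I 1].

Section FunctionField.
Variables (K F : fieldType) (iota : {rmorphism K -> F}).

Definition evalF (m : nat) (xi : 'I_m -> F) (f : {mpoly K[m]}) : F :=
  mmap iota xi f.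

(* The ideal of the Zariski closure of the point xi of F^m, i.e. of the affine
   variety with generic point xi and coordinate ring K[xi]. *)
Definition vanishing (m : nat) (xi : 'I_m -> F) : {pred {mpoly K[m]}} :=
  [pred f | evalF xi f == 0].

(* The subfield K(xi) of F. *)
Definition gen_field (m : nat) (xi : 'I_m -> F) : set F :=
  [set z | exists f g : {mpoly K[m]},
     evalF xi g != 0 /\ z = evalF xi f / evalF xi g].

(* Primes of K[xi], as primes of K[X_1, ..., X_m] containing the kernel. *)
Definition prime_of (m : nat) (xi : 'I_m -> F)
    (P : {pred {mpoly K[m]}}) : Prop :=
  [/\ idealr_closed P, prime_idealr_closed P & {subset vanishing xi <= P}].

Definition localization (m : nat) (xi : 'I_m -> F)
    (P : {pred {mpoly K[m]}}) : set F :=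
  [set z | exists f g : {mpoly K[m]},
     g \notin P /\ z = evalF xi f / evalF xi g].

(* Jacobian criterion at the point P of a curve with ideal [vanishing xi] in
   m-space: the Jacobian matrix has rank m - 1 modulo P. *)
Definition jacobian_at (m : nat) (xi : 'I_m -> F)
    (P : {pred {mpoly K[m]}}) : Prop :=
  exists (f : 'I_m.-1 -> {mpoly K[m]}) (g : 'I_m.-1 -> 'I_m),
    (forall k, f k \in vanishing xi) /\
    \det (\matrix_(k < m.-1, l < m.-1) mderiv (g l) (f k)) \notin P.

End FunctionField.

Definition nonunits (F : fieldType) (O : set F) : set F :=
  [set a | O a /\ forall b, O b -> a * b <> 1].

Definition local_subring (F : fieldType) (O : set F) : Prop :=
  subring_closed (mem O) /\
  (forall a b, nonunits O a -> nonunits O b -> nonunits O (a + b)).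

Definition dominates (F : fieldType) (D O : set F) : Prop :=
  O `<=` D /\ nonunits O `<=` nonunits D.

(* An integral scheme of finite type over K with function field F is given, in
   the style of Zariski and Chevalley (EGA I, 8), by the set of its local rings
   inside F: the union of the sets of local rings of finitely many finitely
   generated K-algebras K[xi_i] with fraction field F (the affine charts,
   xi_i being the generic point in the coordinates of chart i).  Points of
   different charts are glued when they have the same local ring, and the
   scheme is separated iff no local ring dominates two distinct local rings of
   the scheme. *)
Definition is_scheme_point (K F : fieldType) (iota : {rmorphism K -> F})
    (chart : finType) (dim : chart -> nat)
    (xi : forall i : chart, 'I_(dim i) -> F) (O : set F) : Prop :=
  exists (i : chart) (P : {pred {mpoly K[dim i]}}),
    prime_of iota (xi i) P /\ O = localization iota (xi i) P.

(* [embdim i] is the dimension of the affine space containing chart i. *)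
Record curve (K : fieldType) := Curve {
  funfield : fieldType;
  cst : {rmorphism K -> funfield};
  chart : finType;
  embdim : chart -> nat;
  coord : forall i : chart, 'I_(embdim i) -> funfield;
  chart_nonempty : (0 < #|chart|)%N;
  coord_gen : forall i, gen_field cst (@coord i) = setT;
  chart_affine_curve : forall i, affine_curve (vanishing cst (@coord i));
  separated : forall O1 O2 D : set funfield,
    is_scheme_point cst coord O1 -> is_scheme_point cst coord O2 ->
    local_subring D -> dominates D O1 -> dominates D O2 -> O1 = O2
}.

Section Curves.
Variables (K : fieldType) (C : curve K).
Local Notation F := (funfield C).

(* The points are the scheme-theoretic ones, identified with their local
   rings. *)
Definition points : set (set F) :=
  [set O | is_scheme_point (cst C) (@coord K C) O].

(* The value at the point O of a rational function z on C, when defined and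
   in K: z is in O and congruent to c modulo the maximal ideal of O. *)
Definition has_value (O : set F) (z : F) (c : K) : Prop :=
  O z /\ nonunits O (z - cst C c).

(* C(K): the points with residue field K. *)
Definition rat_points : set (set F) :=
  [set O | points O /\ forall z, O z -> exists c, has_value O z c].

Definition smooth_at (O : set F) : Prop :=
  exists (i : chart C) (P : {pred {mpoly K[embdim i]}}),
    [/\ prime_of (cst C) (@coord K C i) P,
        O = localization (cst C) (@coord K C i) P &
        jacobian_at (cst C) (@coord K C i) P].

Definition smooth_curve : Prop := forall O, points O -> smooth_at O.

(* A rational map phi from C to affine n-space is an n-tuple of rational
   functions on C. *)
Section RationalMap.
Variables (n : nat) (phi : 'I_n -> F).

(* phi takes its values in the closed subvariety with ideal I. *)
Definition maps_into (I : {pred {mpoly K[n]}}) : Prop :=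
  forall f, f \in I -> evalF (cst C) phi f = 0.

(* The image of phi is Zariski dense in the closed subvariety with ideal I. *)
Definition dominant (I : {pred {mpoly K[n]}}) : Prop :=
  forall f, evalF (cst C) phi f = 0 -> f \in I.

(* For phi dominant onto the curve C', the function field of C' is embedded in
   F with image K(phi), and F is algebraic over it: separability says that
   every element of F is a root of a separable polynomial over K(phi). *)
Definition separable_map : Prop :=
  forall z : F, exists p : {poly F},
    [/\ forall k, gen_field (cst C) phi p`_k, separable_poly p & root p z].

(* phi(C(K)) *)
Definition rat_image : set 'rV[K]_n :=
  [set y | exists O, rat_points O /\ forall k, has_value O (phi k) (y 0 k)].

End RationalMap.
End Curves.

Arguments points {K} C _.
Arguments rat_points {K} C _.

Definition ample (K : fieldType) : Prop :=
  forall C : curve K, smooth_curve C -> rat_points C !=set0 ->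
    infinite_set (rat_points C).

Definition affine_points (K : fieldType) (K0 : {pred K}) (n : nat)
    : set 'rV[K]_n :=
  [set y | forall k, y 0 k \in K0].

Arguments rat_image {K C n} phi _.
Arguments affine_points {K} K0 n _.

(* Main.v *)
(* Expanding at a simple rational point embeds the function field F = K(C) in
   K((t)).  Two facts about this embedding carry the proof.

   First, if K is ample, then finitely many power series y_j in K[[t]] which are
   algebraic over K(t) can be specialized to elements of K, preserving all
   polynomial relations over K and one given inequation.  Cutting off a long
   enough initial segment of each y_j replaces y_j by a simple root w_j, modulo
   t, of a polynomial over K[t]; then the algebra generated over K by t, the w_j
   and the inverse of the product of the derivatives is the coordinate ring of a
   smooth affine curve with a rational point at t = 0, which is geometrically
   integral because K[[t]] is, compatibly with base change.  Ampleness yields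
   infinitely many points, and only finitely many violate the inequation.

   Second, as phi is separable, some coordinate phi_k has a nonzero derivative
   d(phi_k)/dt, and then F is separable over K(phi_k).  By the first fact there
   is a rational point where phi_k - e is a uniformizer (e the value of phi_k),
   so that F embeds in K((t)) with phi_k = e + t.  Substituting a_i t for t gives
   several embeddings, and the first fact applied to all of them together gives
   x != 0 in K such that every e + a_i x is a value of phi_k at a rational point.

   Let a != 0 and c be elements of K, c not in K0.  With scalars d and d a, for d
   among 1, c, 1 + c, some d makes both d x and d a x lie outside K0.  If e is in
   K0, then a is the quotient of s - e and s' - e for two values s, s' outside
   K0; if no value at such a point is in K0, this is immediate.  So the set of
   points to be counted has a square which surjects onto K^*, and it has as many
   elements as its square. *)
From HB Require Import structures.
From mathcomp Require Import all_boot all_order all_algebra.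
From mathcomp Require Import mathcomp_extra boolp classical_sets functions.
From mathcomp Require Import cardinality.
From mathcomp Require Import ring separable.
From mathcomp Require Import mpoly.
Require Import Defs.

Set Implicit Arguments.
Unset Strict Implicit.
Unset Printing Implicit Defensive.

Import GRing.Theory.

Local Open Scope ring_scope.

Local Notation "x %:F" := (@FracField.tofrac _ x).

(** * Formal power series *)

Section PowerSeries.
Variable K : fieldType.

(** A wrapper around coefficient sequences, so that multiplication is convolution and not the
    pointwise product of functions. *)
Record pseries := PSeries { pcoef : nat -> K }.

HB.instance Definition _ := gen_eqMixin pseries.
HB.instance Definition _ := gen_choiceMixin pseries.

Lemma psP (f g : pseries) : pcoef f =1 pcoef g -> f = g.
Proof. by case: f g => [f] [g] /= /funext ->. Qed.

Definition ps_add f g := PSeries (fun n => pcoef f n + pcoef g n).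
Definition ps_opp f := PSeries (fun n => - pcoef f n).
Definition ps_mul f g :=
  PSeries (fun n => \sum_(i < n.+1) pcoef f i * pcoef g (n - i)).
Definition ps_of_poly (p : {poly K}) := PSeries (fun n => p`_n).

Lemma ps_addA : associative ps_add.
Proof. by move=> f g h; apply: psP => n /=; rewrite addrA. Qed.
Lemma ps_addC : commutative ps_add.
Proof. by move=> f g; apply: psP => n /=; rewrite addrC. Qed.
Lemma ps_add0 : left_id (ps_of_poly 0) ps_add.
Proof. by move=> f; apply: psP => n /=; rewrite coef0 add0r. Qed.
Lemma ps_addN : left_inverse (ps_of_poly 0) ps_opp ps_add.
Proof. by move=> f; apply: psP => n /=; rewrite coef0 addNr. Qed.

HB.instance Definition _ :=
  GRing.isZmodule.Build pseries ps_addA ps_addC ps_add0 ps_addN.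

Definition ps_trunc N (f : pseries) : {poly K} := \poly_(i < N) pcoef f i.

Lemma coef_ps_trunc N f i : (i < N)%N -> (ps_trunc N f)`_i = pcoef f i.
Proof. by move=> iN; rewrite coef_poly iN. Qed.

(** A coefficient of a product depends only on coefficients of at most the same index, so the ring
    axioms are inherited from [{poly K}] by truncation. *)
Lemma pcoef_mul_trunc N f g n : (n < N)%N ->
  pcoef (ps_mul f g) n = (ps_trunc N f * ps_trunc N g)`_n.
Proof.
move=> nN; rewrite coefM /=; apply: eq_bigr => i _.
have iN : (i < N)%N by apply: leq_trans nN; rewrite ltn_ord.
by rewrite !coef_ps_trunc // (leq_ltn_trans (leq_subr _ _)).
Qed.

Lemma coefM_eq (p q p' q' : {poly K}) n :
  (forall i, (i <= n)%N -> p`_i = p'`_i) ->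
  (forall i, (i <= n)%N -> q`_i = q'`_i) -> (p * q)`_n = (p' * q')`_n.
Proof.
move=> pp' qq'; rewrite !coefM; apply: eq_bigr => i _.
by rewrite pp' ?qq' ?leq_subr // -ltnS.
Qed.

Lemma ps_mulA : associative ps_mul.
Proof.
move=> f g h; apply: psP => n; rewrite !(pcoef_mul_trunc _ _ (ltnSn n)).
transitivity ((ps_trunc n.+1 f * (ps_trunc n.+1 g * ps_trunc n.+1 h))`_n).
  apply: coefM_eq => // i lin.
  by rewrite coef_ps_trunc // (@pcoef_mul_trunc n.+1).
rewrite mulrA; apply: coefM_eq => // i lin.
by rewrite coef_ps_trunc // (@pcoef_mul_trunc n.+1).
Qed.

Lemma ps_mulC : commutative ps_mul.
Proof.
by move=> f g; apply: psP => n; rewrite !(pcoef_mul_trunc _ _ (ltnSn n)) mulrC.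
Qed.

Lemma ps_mul1 : left_id (ps_of_poly 1) ps_mul.
Proof.
move=> f; apply: psP => n; rewrite (pcoef_mul_trunc _ _ (ltnSn n)).
rewrite -[RHS](coef_ps_trunc _ (ltnSn n)) -[in RHS](mul1r (ps_trunc _ _)).
by apply: coefM_eq => // i lin; rewrite coef_ps_trunc.
Qed.

Lemma ps_mulDl : left_distributive ps_mul ps_add.
Proof.
move=> f g h; apply: psP => n /=; rewrite -big_split /=.
by apply: eq_bigr => i _; rewrite mulrDl.
Qed.

Lemma ps_one_neq0 : ps_of_poly 1 != 0.
Proof.
apply/eqP => /(congr1 (fun f => pcoef f 0%N)) /=.
by rewrite coef1 coef0 => /eqP; rewrite oner_eq0.
Qed.

HB.instance Definition _ := GRing.Zmodule_isComNzRing.Build pseries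
  ps_mulA ps_mulC ps_mul1 ps_mulDl ps_one_neq0.

Lemma pcoefD (f g : pseries) n : pcoef (f + g) n = pcoef f n + pcoef g n.
Proof. by []. Qed.
Lemma pcoefB (f g : pseries) n : pcoef (f - g) n = pcoef f n - pcoef g n.
Proof. by []. Qed.
Lemma pcoef_0 n : pcoef 0 n = 0.
Proof. by rewrite /= coef0. Qed.
Lemma pcoef_1 n : pcoef 1 n = (n == 0%N)%:R.
Proof. by rewrite /= coef1. Qed.
Lemma pcoefM (f g : pseries) n :
  pcoef (f * g) n = \sum_(i < n.+1) pcoef f i * pcoef g (n - i).
Proof. by []. Qed.
Lemma pcoefM_trunc (f g : pseries) n :
  pcoef (f * g) n = (ps_trunc n.+1 f * ps_trunc n.+1 g)`_n.
Proof. exact: pcoef_mul_trunc. Qed.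

Lemma pcoef_sum (I : Type) (r : seq I) (P : pred I) (F : I -> pseries) n :
  pcoef (\sum_(i <- r | P i) F i) n = \sum_(i <- r | P i) pcoef (F i) n.
Proof. by apply: (big_morph (pcoef^~ n)); [|exact: pcoef_0]. Qed.

Lemma pcoef0M (f g : pseries) : pcoef (f * g) 0 = pcoef f 0 * pcoef g 0.
Proof. by rewrite pcoefM big_ord1. Qed.

Lemma ps_of_poly_zmod : zmod_morphism ps_of_poly.
Proof. by move=> p q; apply: psP => n /=; rewrite coefB. Qed.

Lemma ps_of_poly_monoid : monoid_morphism ps_of_poly.
Proof.
split=> // p q; apply: psP => n; rewrite /= coefM.
by apply: eq_bigr.
Qed.

HB.instance Definition _ :=
  GRing.isZmodMorphism.Build {poly K} pseries ps_of_poly ps_of_poly_zmod.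
HB.instance Definition _ :=
  GRing.isMonoidMorphism.Build {poly K} pseries ps_of_poly ps_of_poly_monoid.

Definition psC : K -> pseries := ps_of_poly \o polyC.
HB.instance Definition _ := GRing.RMorphism.on psC.
Definition psX : pseries := ps_of_poly 'X.

Lemma ps_of_poly_inj : injective ps_of_poly.
Proof. by move=> p q pq; apply/polyP => i;
  have /= -> := congr1 (pcoef^~ i) pq. Qed.

Lemma pcoefC c n : pcoef (psC c) n = if n == 0%N then c else 0.
Proof. by rewrite /= coefC. Qed.

Lemma pcoefCM c f n : pcoef (psC c * f) n = c * pcoef f n.
Proof.
rewrite pcoefM big_ord_recl /= coefC /= subn0 big1 ?addr0 // => i _.
by rewrite coefC mul0r.
Qed.

Lemma pcoefXM f n : pcoef (psX * f) n = if n is n'.+1 then pcoef f n' else 0.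
Proof.
case: n => [|n]; first by rewrite pcoef0M /= coefX mul0r.
rewrite pcoefM big_ord_recl big_ord_recl big1 /= ?coefX ?mul0r ?add0r.
  by rewrite mul1r addr0 /bump /= subn1.
by move=> i _; rewrite coefX mul0r.
Qed.

Lemma pcoefXnM v f n :
  pcoef (psX ^+ v * f) n = if (n < v)%N then 0 else pcoef f (n - v).
Proof.
elim: v n => [|v IHv] n; first by rewrite mul1r subn0.
by rewrite exprS -mulrA pcoefXM; case: n => // n; rewrite IHv.
Qed.

Definition ps_tail v (f : pseries) := PSeries (fun n => pcoef f (n + v)).

Lemma ps_trunc_tail v f :
  f = ps_of_poly (ps_trunc v f) + psX ^+ v * ps_tail v f.
Proof.
apply: psP => n; rewrite pcoefD pcoefXnM /= coef_poly.
by case: ltnP => [|vn]; rewrite ?addr0 // add0r subnK.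
Qed.

Section Inverse.
Variable f : pseries.

(** The first [n] coefficients of the inverse, each obtained by solving the convolution identity for
    its last term. The whole list is carried along because every earlier coefficient enters. *)
Fixpoint ps_inv_seq n : seq K :=
  if n is n'.+1 then
    let s := ps_inv_seq n' in
    rcons s ((pcoef f 0)^-1 *
      ((n' == 0%N)%:R - \sum_(i < n') pcoef f (n' - i) * s`_i))
  else [::].

Lemma size_ps_inv_seq n : size (ps_inv_seq n) = n.
Proof. by elim: n => //= n IHn; rewrite size_rcons IHn. Qed.

Lemma nth_ps_inv_seq n m : (n < m)%N -> (ps_inv_seq m)`_n = (ps_inv_seq
  n.+1)`_n.
Proof.
elim: m => // m IHm; rewrite ltnS leq_eqVlt => /predU1P [-> //|nm].
by rewrite [ps_inv_seq m.+1]/= nth_rcons size_ps_inv_seq nm IHm.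
Qed.

Definition ps_inverse := PSeries (fun n => (ps_inv_seq n.+1)`_n).

Lemma ps_inverseP : pcoef f 0 != 0 -> ps_inverse * f = 1.
Proof.
move=> f0; apply: psP => n; rewrite pcoefM pcoef_1 big_ord_recr /= subnn.
rewrite nth_rcons size_ps_inv_seq ltnn eqxx mulrAC mulVf // mul1r addrC.
rewrite [X in _ + X](_ : _ = \sum_(i < n) pcoef f (n - i) * (ps_inv_seq n)`_i).
  by rewrite subrK.
by apply: eq_bigr => i _; rewrite mulrC; congr (_ * _); rewrite nth_ps_inv_seq.
Qed.

End Inverse.

Definition ps_unit : {pred pseries} := fun f => pcoef f 0 != 0.
Definition ps_inv f := if f \in ps_unit then ps_inverse f else f.

Lemma ps_mulVr : {in ps_unit, left_inverse 1 ps_inv *%R}.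
Proof. by move=> f fu; rewrite /ps_inv fu ps_inverseP. Qed.

Lemma ps_unitP (f g : pseries) : g * f = 1 -> f \in ps_unit.
Proof.
move=> /(congr1 (pcoef^~ 0%N)); rewrite pcoef0M pcoef_1 /= => gf.
by apply/negP => /eqP f0; move/eqP: gf; rewrite f0 mulr0 eq_sym oner_eq0.
Qed.

Lemma ps_inv_out : {in [predC ps_unit], ps_inv =1 id}.
Proof. by move=> f; rewrite /ps_inv inE => /negPf ->. Qed.

HB.instance Definition _ := GRing.ComNzRing_hasMulInverse.Build pseries
  ps_mulVr ps_unitP ps_inv_out.

Lemma ps_unitE (f : pseries) : (f \is a GRing.unit) = (pcoef f 0 != 0).
Proof. by []. Qed.

Lemma ps_order (f : pseries) : f != 0 ->
  exists v u, f = psX ^+ v * u /\ pcoef u 0 != 0.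
Proof.
move=> f0; have fn0 : exists n, pcoef f n != 0.
  apply: contrapT => /forallNP f_0; case/eqP: f0; apply: psP => n.
  by rewrite pcoef_0; apply/eqP/negP => /negP/(f_0 n).
case: (ex_minnP fn0) => v fv vmin.
exists v, (ps_tail v f); split=> //.
rewrite {1}(ps_trunc_tail v f) [ps_trunc _ _](_ : _ = 0) ?raddf0 ?add0r //.
apply/polyP => i; rewrite coef_poly coef0; case: ltnP => // iv.
by apply/eqP; apply: contraTT iv; rewrite -leqNgt; exact: vmin.
Qed.

Lemma ps_idomain (f g : pseries) : f * g = 0 -> (f == 0) || (g == 0).
Proof.
move=> fg0; apply/norP => -[/ps_order [v [u [fE u0]]] /ps_order [w [u' [gE
  u'0]]]].
have /(congr1 (pcoef^~ (v + w)%N)) := fg0.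
rewrite fE gE mulrACA -exprD pcoefXnM ltnn subnn pcoef0M pcoef_0.
by move=> /eqP; rewrite mulf_eq0 (negPf u0) (negPf u'0).
Qed.

HB.instance Definition _ := GRing.ComUnitRing_isIntegral.Build pseries
  ps_idomain.

(** * Derivation, substitution and Frobenius on K[[t]] *)

Definition ps_deriv (f : pseries) := PSeries (fun n => pcoef f n.+1 *+ n.+1).

Lemma ps_derivD f g : ps_deriv (f + g) = ps_deriv f + ps_deriv g.
Proof. by apply: psP => n; rewrite /= mulrnDl. Qed.

Lemma ps_derivM f g : ps_deriv (f * g) = ps_deriv f * g + f * ps_deriv g.
Proof.
(* The truncation is at [n.+2] because the derivative reads the coefficient of index n + 1;
   Leibniz's rule then comes from polynomials. *)
apply: psP => n; transitivity (((ps_trunc n.+2 f * ps_trunc n.+2 g)^`())`_n).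
  by rewrite coef_deriv /= -(pcoef_mul_trunc _ _ (ltnSn n.+1)).
rewrite derivM coefD pcoefD !pcoefM_trunc; congr (_ + _).
  apply: coefM_eq => i lin; rewrite ?(coef_ps_trunc, coef_deriv) //.
  by rewrite ltnS leqW.
apply: coefM_eq => i lin; rewrite ?(coef_ps_trunc, coef_deriv) //.
by rewrite ltnS leqW.
Qed.

Lemma ps_derivC c : ps_deriv (psC c) = 0.
Proof. by apply: psP => n; rewrite pcoef_0 /= coefC mul0rn. Qed.

Lemma ps_derivX : ps_deriv psX = 1.
Proof. by apply: psP => n; rewrite pcoef_1 /= coefX eqSS; case: n => [|n] //=;
  rewrite mul0rn. Qed.

(** The substitution of a t for t. *)
Definition ps_scale a (f : pseries) := PSeries (fun n => a ^+ n * pcoef f n).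

Lemma ps_scale_zmod a : zmod_morphism (ps_scale a).
Proof. by move=> f g; apply: psP => n; rewrite /= mulrBr. Qed.

Lemma ps_scale_monoid a : monoid_morphism (ps_scale a).
Proof.
split=> [|f g]; apply: psP => n.
  by rewrite /= coef1; case: n => [|n]; rewrite ?mulr0 ?mulr1.
rewrite /= mulr_sumr; apply: eq_bigr => i _.
have -> : a ^+ n = a ^+ i * a ^+ (n - i) by rewrite -exprD subnKC // -ltnS.
by rewrite mulrACA.
Qed.

HB.instance Definition _ a :=
  GRing.isZmodMorphism.Build pseries pseries (ps_scale a) (ps_scale_zmod a).
HB.instance Definition _ a :=
  GRing.isMonoidMorphism.Build pseries pseries (ps_scale a) (ps_scale_monoid a).

Lemma ps_scaleC a c : ps_scale a (psC c) = psC c.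
Proof.
by apply: psP => n; rewrite /= coefC; case: n => [|n]; rewrite /= ?mul1r ?mulr0.
Qed.

Lemma ps_scaleX a : ps_scale a psX = psC a * psX.
Proof.
apply: psP => n; rewrite pcoefCM /= coefX.
by case: n => [|[|n]]; rewrite /= ?mulr0 ?expr1.
Qed.

Lemma ps_scale_inj a : a != 0 -> injective (ps_scale a).
Proof.
move=> a0 f g fg; apply: psP => n; have := congr1 (pcoef^~ n) fg.
by move=> /= /mulfI; apply; rewrite expf_neq0.
Qed.

(** The p-th power is additive in characteristic p; the tail of [f] past degree n contributes only
    from degree p (n + 1) on. *)
Lemma ps_Frobenius p (f : pseries) n : p \in [pchar K] ->
  pcoef (f ^+ p) (p * n) = pcoef f n ^+ p.
Proof.
move=> pK; have p_gt0 : (0 < p)%N by have /andP [/prime_gt0] := pK.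
have pR : p \in [pchar pseries] by exact: (rmorph_pchar psC).
have fE : f = \sum_(i < n.+1) psC (pcoef f i) * psX ^+ i
            + psX ^+ n.+1 * ps_tail n.+1 f.
  rewrite {1}(ps_trunc_tail n.+1 f); congr (_ + _).
  rewrite /ps_trunc poly_def raddf_sum /=; apply: eq_bigr => i _.
  by rewrite -mul_polyC rmorphM rmorphXn.
rewrite {1}fE -(pFrobenius_autE pR) rmorphD rmorph_sum pcoefD pcoef_sum.
rewrite [X in _ + X](_ : _ = 0) ?addr0.
  rewrite (bigD1 ord_max) //= big1 => [|i ni]; last first.
    rewrite pFrobenius_autE exprMn -rmorphXn pcoefCM -exprM -[_ ^+ (_ *
      _)]mulr1.
    rewrite pcoefXnM (mulnC i p); case: ifP => [|_]; first by rewrite mulr0.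
    rewrite pcoef_1 subn_eq0 leq_pmul2l // leqNgt.
    by rewrite ltn_neqAle ni -ltnS ltn_ord mulr0.
  rewrite pFrobenius_autE exprMn -rmorphXn addr0 pcoefCM -exprM (mulnC n p).
  by rewrite -[psX ^+ _]mulr1 pcoefXnM ltnn subnn pcoef_1 mulr1.
by rewrite /= pFrobenius_autE exprMn -exprM pcoefXnM (mulnC n.+1 p) ltn_pmul2l
  // ltnSn.
Qed.

End PowerSeries.

(** * Linear relations and evaluation of polynomials *)

(* Linear disjointness of L and K[[t]] over K, read on coefficients; with the
   Frobenius of K in place of j it also yields the extraction of p-th roots
   of relations below. *)
Lemma linear_relations_descend (K L : fieldType) (j : {rmorphism K -> L}) s
    (u : 'I_s -> nat -> K) (g : 'rV[L]_s) :
  (forall n, \sum_i g 0 i * j (u i n) = 0) ->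
  exists B : 'M[K]_s, (exists h : 'rV[L]_s, g = h *m map_mx j B) /\
    forall k n, \sum_i B k i * u i n = 0.
Proof.
move=> gu; pose M r : 'M[K]_(s, r) := \matrix_(i, n) u i n.
(* The ranks of the truncated coefficient matrices are at most [s]. Where the rank is maximal, the
   left kernel no longer shrinks when columns are added, so it kills all coefficients. *)
have [r rmax] : exists r, forall r', (\rank (M r') <= \rank (M r))%N.
  have ex0 : exists d, `[< exists r, \rank (M r) = d >].
    by exists (\rank (M 0%N)); apply/asboolP; exists 0%N.
  have ub d : `[< exists r, \rank (M r) = d >] -> (d <= s)%N.
    by move=> /asboolP [r <-]; apply: rank_leq_row.
  case: (ex_maxnP ex0 ub) => d /asboolP [r rd] dmax.
  by exists r => r'; rewrite rd dmax //; apply/asboolP; exists r'.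
exists (kermx (M r)); split.
  apply/submxP; rewrite map_kermx; apply/sub_kermxP/rowP => n.
  by rewrite !mxE -[RHS](gu n); apply: eq_bigr => i _; rewrite !mxE.
move=> k n; pose r' := maxn r n.+1.
have nr' : (n < r')%N by rewrite leq_max ltnSn orbT.
have sub : (kermx (M r') <= kermx (M r))%MS.
  apply/sub_kermxP/matrixP => a b.
  have br' : (b < r')%N by rewrite leq_max ltn_ord.
  have /matrixP /(_ a (Ordinal br')) := mulmx_ker (M r').
  by rewrite !mxE => E; rewrite -[RHS]E; apply: eq_bigr => i _; rewrite !mxE.
have rk : \rank (kermx (M r')) = \rank (kermx (M r)).
  apply/eqP; rewrite eqn_leq (mxrankS sub) /= !mxrank_ker.
  by rewrite leq_sub2l.
have /sub_kermxP /matrixP /(_ k (Ordinal nr')) : (kermx (M r) <= kermx (M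
  r'))%MS.
  by rewrite -(mxrank_leqif_sup sub) rk.
by rewrite !mxE => E; rewrite -[RHS]E; apply: eq_bigr => i _; rewrite !mxE.
Qed.

Lemma mpoly_ring_ind (n : nat) (K : fieldType) (P : {mpoly K[n]} -> Prop) :
  (forall c, P c%:MP) -> (forall i, P 'X_i) ->
  (forall f g, P f -> P g -> P (f + g)) ->
  (forall f g, P f -> P g -> P (f * g)) -> forall f, P f.
Proof.
move=> PC PX PD PM; elim/mpolyind => [|c m p _ _ Pp].
  by rewrite -mpolyC0; apply: (PC).
apply: PD => //; rewrite -mul_mpolyC; apply: (PM) => //.
rewrite mpolyXE_id; apply: (big_ind P) => [|f g|i _]; [|exact: PM|].
  by rewrite -mpolyC1; apply: (PC).
elim: (m i) => [|e IHe]; last by rewrite exprS; apply: (PM).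
by rewrite expr0 -mpolyC1; apply: (PC).
Qed.

Lemma mderivXU (K : fieldType) n (i k : 'I_n) :
  mderiv k ('X_i : {mpoly K[n]}) = (i == k)%:R%:MP.
Proof.
rewrite mderivX mnm1E; case: eqP => [->|_]; last by rewrite scale0r mpolyC0.
rewrite scale1r mpolyC1 -[RHS]mpolyX0; congr 'X_[_].
by apply/mnmP => l; rewrite mnmBE mnm0E subnn.
Qed.

Section Evaluation.
Variable K : fieldType.

Lemma eq_mmap (A : nzRingType) n (i j : K -> A) (x y : 'I_n -> A) f :
  i =1 j -> x =1 y -> mmap i x f = mmap j y f.
Proof.
move=> ij xy; apply: eq_bigr => m _; rewrite ij; congr (_ * _).
by apply: eq_bigr => k _; rewrite xy.
Qed.

Lemma rmorph_mmap (A B : comNzRingType) (s : {rmorphism A -> B}) n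
    (i : K -> A) (x : 'I_n -> A) f :
  s (mmap i x f) = mmap (s \o i) (s \o x) f.
Proof.
rewrite rmorph_sum; apply: eq_bigr => m _; rewrite rmorphM; congr (_ * _).
by rewrite rmorph_prod; apply: eq_bigr => k _; rewrite rmorphXn.
Qed.

Variables (A : comNzRingType) (i : {rmorphism K -> A}).

Lemma mmapXU n (x : 'I_n -> A) k : mmap i x 'X_k = x k.
Proof. by rewrite mmapX mmap1U. Qed.

Lemma mmap_polyC n (x : 'I_n -> A) c : mmap i x c%:MP = i c.
Proof. exact: mmapC. Qed.

Lemma mmap_comp_mpoly n k (lq : n.-tuple {mpoly K[k]}) (x : 'I_k -> A) f :
  mmap i x (f \mPo lq) = mmap i (fun l => mmap i x (tnth lq l)) f.
Proof.
rewrite /comp_mpoly rmorph_mmap; apply: eq_mmap => // c /=.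
by rewrite mmap_polyC.
Qed.

Lemma deriv_mmap (D : A -> A) n (x : 'I_n -> A) f :
  (forall a b, D (a + b) = D a + D b) ->
  (forall a b, D (a * b) = D a * b + a * D b) ->
  (forall c, D (i c) = 0) ->
  D (mmap i x f) = \sum_k mmap i x (mderiv k f) * D (x k).
Proof.
move=> DD DM DC; elim/mpoly_ring_ind: f => [c|l|f g Df Dg|f g Df Dg].
- by rewrite mmap_polyC DC big1 // => k _; rewrite mderivC raddf0 mul0r.
- rewrite mmapXU (bigD1 l) //= big1 => [|k kl]; rewrite mderivXU mmap_polyC.
    by rewrite eqxx rmorph1 mul1r addr0.
  by rewrite eq_sym (negPf kl) rmorph0 mul0r.
- rewrite raddfD DD Df Dg -big_split /=; apply: eq_bigr => k _.
  by rewrite -mulrDl -!raddfD.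
- rewrite rmorphM DM Df Dg mulr_suml mulr_sumr -big_split /=.
  by apply: eq_bigr => k _; rewrite mderivM rmorphD !rmorphM; ring.
Qed.

End Evaluation.

(** First-order Taylor expansion at [c]. For a product, f g - f(c) g(c) is split as f (g - g(c)) +
    g(c) (f - f(c)). *)
Lemma mpoly_hadamard (K : fieldType) n (c : 'I_n -> K) (f : {mpoly K[n]}) :
  exists G : 'I_n -> {mpoly K[n]},
    f - (meval c f)%:MP = \sum_j G j * ('X_j - (c j)%:MP) /\
    forall j, meval c (G j) = meval c (mderiv j f).
Proof.
elim/mpoly_ring_ind: f => [a|l|f g [F [fE F_c]] [G [gE G_c]]|f g [F [fE F_c]] [G
  [gE G_c]]].
- exists (fun=> 0); rewrite mevalC subrr; split=> [|j].
    by rewrite big1 // => j _; rewrite mul0r.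
  by rewrite mderivC.
- exists (fun j => (j == l)%:R); split=> [|j].
    rewrite (bigD1 l) //= big1 => [|k /negPf ->]; last by rewrite mul0r.
    by rewrite eqxx mul1r addr0 mevalXU.
  by rewrite mderivXU mevalC rmorph_nat eq_sym.
- exists (fun j => F j + G j); split=> [|j]; last first.
    by rewrite !raddfD /= F_c G_c.
  rewrite raddfD /= rmorphD /= opprD addrACA fE gE -big_split /=.
  by apply: eq_bigr => j _; rewrite mulrDl.
- exists (fun j => f * G j + (meval c g)%:MP * F j); split=> [|j]; last first.
    by rewrite mderivM !raddfD /= !mevalM mevalC F_c G_c; ring.
  have -> : f * g - (meval c (f * g))%:MP =
      f * (g - (meval c g)%:MP) + (meval c g)%:MP * (f - (meval c f)%:MP).
    by rewrite mevalM rmorphM /=; ring.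
  rewrite fE gE !mulr_sumr -big_split /=.
  by apply: eq_bigr => j _; ring.
Qed.

(** * Numerators and denominators in fraction fields *)

Lemma fracP (R : idomainType) (x : {fraction R}) :
  exists n d, d != 0 /\ x = n%:F / d%:F.
Proof.
elim/quotW: x => y; exists (\n_y), (\d_y).
split; first exact: denom_ratioP.
have d0 : (\d_y)%:F != 0 by rewrite tofrac_eq0 denom_ratioP.
apply: (mulIf d0); rewrite divfK //.
rewrite -[LHS]/(FracField.mul _ _) !piE /FracField.mulf.
rewrite !numden_Ratio ?oner_eq0 // mulr1; apply/eqmodP.
rewrite /= FracField.equivfE !numden_Ratio ?oner_eq0 ?mulr1 ?denom_ratioP //.
by rewrite mulrC.
Qed.

Lemma common_denominator (R : idomainType) s (u : 'I_s -> {fraction R}) :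
  exists (d : R) (n : 'I_s -> R), d != 0 /\ forall k, u k = (n k)%:F / d%:F.
Proof.
have /choice [nd ndP] : forall k, exists nd : R * R, nd.2 != 0 /\ u k = nd.1%:F
  / nd.2%:F.
  by move=> k; have [n [d [d0 E]]] := fracP (u k); exists (n, d).
exists (\prod_k (nd k).2), (fun k => (nd k).1 * \prod_(l | l != k) (nd l).2).
split=> [|k]; first by apply/prodf_neq0 => k _; have [] := ndP k.
have [d0 ->] := ndP k.
have dl0 : (\prod_(l | l != k) (nd l).2)%:F != 0.
  by rewrite tofrac_eq0; apply/prodf_neq0 => l _; have [] := ndP l.
have -> : \prod_l (nd l).2 = (nd k).2 * \prod_(l | l != k) (nd l).2.
  by rewrite (bigD1 k).
by rewrite !rmorphM -mulf_div divff // mulr1.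
Qed.

(** * Laurent series and separating relations *)

(** The quotient rule does not depend on the chosen fraction: the second hypothesis is the
    derivative of the first. *)
Lemma quotient_rule_wd (A : comNzRingType) (n d n1 d1 n' d' n1' d1' : A) :
  n * d1 = n1 * d -> n' * d1 + n * d1' = n1' * d + n1 * d' ->
  (n' * d - n * d') * d1 ^+ 2 = (n1' * d1 - n1 * d1') * d ^+ 2.
Proof.
move=> E E'.
have -> : (n1' * d1 - n1 * d1') * d ^+ 2 =
  (n1' * d + n1 * d') * (d1 * d) - (n1 * d) * d' * d1 - (n1 * d) * (d1' * d).
  by ring.
by rewrite -E' -E; ring.
Qed.

Lemma quotient_ruleD (F : fieldType) (n d m e n' d' m' e' : F) :
  d != 0 -> e != 0 ->
  ((n' * e + n * e' + (m' * d + m * d')) * (d * e) -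
   (n * e + m * d) * (d' * e + d * e')) / (d * e) ^+ 2 =
  (n' * d - n * d') / d ^+ 2 + (m' * e - m * e') / e ^+ 2.
Proof. by move=> d0 e0; field; rewrite ?d0 ?e0. Qed.

Lemma quotient_ruleM (F : fieldType) (n d m e n' d' m' e' : F) :
  d != 0 -> e != 0 ->
  ((n' * m + n * m') * (d * e) - (n * m) * (d' * e + d * e')) / (d * e) ^+ 2 =
  (n' * d - n * d') / d ^+ 2 * (m / e) + n / d * ((m' * e - m * e') / e ^+ 2).
Proof. by move=> d0 e0; field; rewrite ?d0 ?e0. Qed.

Section Laurent.
Variable K : fieldType.
Local Notation R := (pseries K).
Local Notation L := {fraction pseries K}.

(** K((t)) is encoded as the fraction field of K[[t]]; this embeds the constants. *)
Definition lcst : K -> L := @FracField.tofrac R \o @psC K.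
HB.instance Definition _ := GRing.RMorphism.on lcst.

(** MacLane's criterion for the separability of K((t)) over K. After clearing denominators, the
    coefficients of index p k give relations with coefficients [c] among p-th powers of elements of
    K, and these descend along Frobenius. *)
Lemma Frobenius_linear_relation p s (u : 'I_s -> L) (c : 'rV[K]_s) :
  p \in [pchar K] -> c != 0 -> \sum_k lcst (c 0 k) * u k ^+ p = 0 ->
  exists2 b : 'rV[K]_s, b != 0 & \sum_k lcst (b 0 k) * u k = 0.
Proof.
move=> pK c0 cu; have [d [n [d0 un]]] := common_denominator u.
have p0 : (0 < p)%N by have /andP [/prime_gt0] := pK.
have dF : d%:F != 0 :> L by rewrite tofrac_eq0.
have cn : \sum_k psC (c 0 k) * n k ^+ p = 0.
  apply/eqP; rewrite -tofrac_eq0; apply/eqP.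
  transitivity (d%:F ^+ p * (\sum_k lcst (c 0 k) * u k ^+ p)); last first.
    by rewrite cu mulr0.
  rewrite rmorph_sum mulr_sumr; apply: eq_bigr => k _.
  rewrite un rmorphM rmorphXn expr_div_n /lcst /=.
  by rewrite mulrCA [_ * (_ / _)]mulrC divfK // expf_neq0.
have [k|B [[h cB] nB]] :=
    linear_relations_descend (j := pFrobenius_aut pK) (u := fun k => pcoef (n
      k)) (g := c).
  have E := pcoef_0 K (p * k); rewrite -cn pcoef_sum in E.
  rewrite -[RHS]E; apply: eq_bigr => i _.
  by rewrite pcoefCM ps_Frobenius.
have /matrix0Pn [k [l Bkl]] : B != 0.
  by apply: contraNneq c0 => B0; rewrite cB B0 map_mx0 mulmx0.
exists (row k B); first by apply/matrix0Pn; exists 0, l; rewrite mxE.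
have n0 : \sum_i psC (B k i) * n i = 0.
  by apply: psP => m; rewrite pcoef_sum pcoef_0 -[RHS](nB k m);
    apply: eq_bigr => i _; rewrite pcoefCM.
transitivity ((\sum_i psC (B k i) * n i)%:F / d%:F); last first.
  by rewrite n0 rmorph0 mul0r.
rewrite rmorph_sum mulr_suml.
by apply: eq_bigr => i _; rewrite mxE un rmorphM mulrA.
Qed.

(** The derivation d/dt of K((t)), computed on a chosen fraction; [fr_derivE] shows that the choice
    does not matter. *)
Definition fr_deriv (x : L) : L :=
  let n := sval (cid (fracP x)) in
  let d := sval (cid (svalP (cid (fracP x)))) in
  ((ps_deriv n)%:F * d%:F - n%:F * (ps_deriv d)%:F) / d%:F ^+ 2.

Lemma fr_derivE n d : d != 0 ->
  fr_deriv (n%:F / d%:F) =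
  ((ps_deriv n)%:F * d%:F - n%:F * (ps_deriv d)%:F) / d%:F ^+ 2.
Proof.
move=> d0; rewrite /fr_deriv.
set n1 := sval (cid (fracP _)); set d1 := sval _.
have [d10 E] : d1 != 0 /\ n%:F / d%:F = n1%:F / d1%:F := svalP (cid (svalP (cid
  (fracP _)))).
have dF : d%:F != 0 :> L by rewrite tofrac_eq0.
have d1F : d1%:F != 0 :> L by rewrite tofrac_eq0.
have nd : n * d1 = n1 * d.
  by move/eqP: E; rewrite eqr_div // -!rmorphM tofrac_eq => /eqP.
have nd' := congr1 (@ps_deriv K) nd; rewrite !ps_derivM in nd'.
apply/eqP; rewrite eqr_div ?expf_neq0 //; apply/eqP.
rewrite -!rmorphXn -!rmorphM -!rmorphB -!rmorphM; congr (_%:F).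
exact/esym/quotient_rule_wd.
Qed.

Lemma fr_derivF n : fr_deriv n%:F = (ps_deriv n)%:F.
Proof.
have -> : n%:F = n%:F / 1%:F :> L by rewrite rmorph1 divr1.
rewrite fr_derivE ?oner_neq0 //.
have -> : ps_deriv 1 = 0 :> R by rewrite -[1](rmorph1 (@psC K)) ps_derivC.
by rewrite !rmorph1 rmorph0 mulr0 subr0 expr1n divr1 mulr1.
Qed.

Lemma fr_derivC c : fr_deriv (lcst c) = 0.
Proof. by rewrite fr_derivF ps_derivC rmorph0. Qed.

Lemma fr_derivD x y : fr_deriv (x + y) = fr_deriv x + fr_deriv y.
Proof.
have [n [d [d0 ->]]] := fracP x; have [m [e [e0 ->]]] := fracP y.
have dF : d%:F != 0 :> L by rewrite tofrac_eq0.
have eF : e%:F != 0 :> L by rewrite tofrac_eq0.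
have -> : n%:F / d%:F + m%:F / e%:F = (n * e + m * d)%:F / (d * e)%:F.
  by rewrite rmorphD !rmorphM addf_div.
rewrite !fr_derivE ?mulf_neq0 // !(ps_derivD, ps_derivM) !(rmorphD, rmorphM).
exact: quotient_ruleD.
Qed.

Lemma fr_derivM x y : fr_deriv (x * y) = fr_deriv x * y + x * fr_deriv y.
Proof.
have [n [d [d0 ->]]] := fracP x; have [m [e [e0 ->]]] := fracP y.
have dF : d%:F != 0 :> L by rewrite tofrac_eq0.
have eF : e%:F != 0 :> L by rewrite tofrac_eq0.
have -> : n%:F / d%:F * (m%:F / e%:F) = (n * m)%:F / (d * e)%:F.
  by rewrite !rmorphM mulf_div.
rewrite !fr_derivE ?mulf_neq0 // !(ps_derivD, ps_derivM) !(rmorphD, rmorphM).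
exact: quotient_ruleM.
Qed.

End Laurent.

Section SeparatingRelation.
Variable K : fieldType.
Local Notation R := (pseries K).
Local Notation L := {fraction pseries K}.
Local Notation lcst := (@lcst K).

Lemma msize_leP n (q : {mpoly K[n]}) N :
  (forall m, m \in msupp q -> (mdeg m < N)%N) <-> (msize q <= N)%N.
Proof.
rewrite msizeE; split=> [qN|/bigmax_leqP_seq qN m mq]; last exact: qN.
by apply/bigmax_leqP_seq => m mq _; apply: qN.
Qed.

Lemma msize_mderiv n (q : {mpoly K[n]}) k : mderiv k q != 0 ->
  (msize (mderiv k q) < msize q)%N.
Proof.
move=> q'0; have q0 : q != 0 by apply: contraNneq q'0 => ->; rewrite raddf0.
rewrite (mpolySpred mdeg q0) ltnS; apply/msize_leP => m.
rewrite mcoeff_msupp mcoeff_mderiv => qm.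
have /(@msize_mdeg_lt _ _ _ _) : (m + U_(k))%MM \in msupp q.
  by rewrite mcoeff_msupp; apply: contraNneq qm => ->; rewrite mul0rn.
by rewrite mdegD mdeg1 addn1 (mpolySpred mdeg q0) ltnS.
Qed.

(** As all partial derivatives vanish, every exponent of [q] is divisible by the characteristic p.
    So [q] is a linear combination of p-th powers of monomials, and [Frobenius_linear_relation]
    extracts a root of smaller degree. *)
Lemma mpoly_pth_root n (q : {mpoly K[n]}) (x : 'I_n -> L) :
  q != 0 -> mmap lcst x q = 0 -> (forall k, mderiv k q = 0) ->
  exists r : {mpoly K[n]}, [/\ r != 0, mmap lcst x r = 0 & (msize r < msize
    q)%N].
Proof.
move=> q0 qx q'0.
have mq0 m k : m \in msupp q -> (m k)%:R = 0 :> K.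
  move=> mq; have [->//|mk0] := eqVneq (m k) 0%N.
  have := congr1 (mcoeff (m - U_(k))) (q'0 k).
  rewrite mcoeff_mderiv submK ?lep1mP // mcoeff0 mnmBE mnm1E eqxx subn1 prednK
    ?lt0n //.
  move/eqP; rewrite -[_ *+ _]mulr_natr mulf_eq0 => /orP [|/eqP //].
  by move=> qm; rewrite mcoeff_msupp qm in mq.
(* A nonzero constant does not vanish at [x], so some exponent of [q] is positive; being zero in K,
   it forces a positive characteristic. *)
have [m mq m0] : exists2 m, m \in msupp q & m != 0%MM.
  apply: contrapT => noq; case/negP: q0.
  have qC : q = (q@_0%MM)%:MP.
    apply/mpolyP => m; rewrite mcoeffC; case: eqP => [->|/eqP m0];
      first by rewrite mulr1.
    rewrite mulr0; apply: memN_msupp_eq0; apply/negP => mq; apply: noq.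
    by exists m.
  rewrite qC mpolyC_eq0 -(fmorph_eq0 lcst); move/eqP: qx.
  by rewrite {1}qC mmap_polyC.
have [k mk] : exists k, m k != 0%N.
  apply: contrapT => /forallNP m00; case/eqP: m0; apply/mnmP => k.
  by rewrite mnm0E; apply/eqP/negP => /negP/(m00 k).
have [p pK] : exists p, p \in [pchar K].
  by apply: (@natf0_pchar _ (m k)); rewrite ?lt0n //; apply/eqP/mq0.
have p1 : (1 < p)%N by have /andP [/prime_gt1] := pK.
have dvd l j : l \in msupp q -> (p %| l j)%N.
  by move=> lq; rewrite (dvdn_pcharf pK) mq0.
pose rt (l : 'X_{1..n}) : 'X_{1..n} := [multinom (l j %/ p)%N | j < n].
have rtK l : l \in msupp q -> (rt l *+ p)%MM = l.
  by move=> lq; apply/mnmP => j; rewrite mulmnE mnmE divnK // dvd.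
pose s := size (msupp q); pose mon (j : 'I_s) := nth 0%MM (msupp q) j.
have monq j : mon j \in msupp q by rewrite mem_nth.
have mon_inj : injective (rt \o mon).
  move=> i j /(congr1 (fun l => l *+ p)%MM) /=; rewrite !rtK // => /eqP.
  by rewrite nth_uniq ?msupp_uniq // => /eqP /val_inj.
have [||b b0 bu] := @Frobenius_linear_relation K p s (fun j => mmap1 x (rt (mon
  j)))
   (\row_j q@_(mon j)) pK.
- have sm : (index m (msupp q) < s)%N by rewrite index_mem.
  apply/matrix0Pn; exists 0, (Ordinal sm); rewrite mxE -mcoeff_msupp;
    exact: monq.
- rewrite -[RHS]qx /mmap (big_nth 0%MM) big_mkord; apply: eq_bigr => j _.
  rewrite mxE; congr (_ * _);
    rewrite -[X in _ = mmap1 _ X](rtK _ (monq j)) /mmap1 -prodrXl.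
  by apply: eq_bigr => i _; rewrite mulmnE exprM.
pose r := \sum_j b 0 j *: 'X_[rt (mon j)] : {mpoly K[n]}.
have coefr j : r@_(rt (mon j)) = b 0 j.
  rewrite raddf_sum (bigD1 j) //= mcoeffZ mcoeffX eqxx mulr1 big1 ?addr0 // => i
    ij.
  by rewrite mcoeffZ mcoeffX (inj_eq mon_inj) (negPf ij) mulr0.
exists r; split.
- have /matrix0Pn [i [j bj]] := b0; apply: contraNneq bj => r0.
  by rewrite [i]ord1 -coefr r0 mcoeff0.
- rewrite rmorph_sum -[RHS]bu /=; apply: eq_bigr => j _.
  by rewrite mmapZ mmapX.
- rewrite (mpolySpred mdeg q0) ltnS; apply/msize_leP => l.
  rewrite mcoeff_msupp => rl.
  have [j ->] : exists j, l = rt (mon j).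
    apply: contrapT => /forallNP lr; case/eqP: rl;
      rewrite raddf_sum big1 //= => j _.
    by rewrite mcoeffZ mcoeffX; case: eqP => [E|]; rewrite ?mulr0 //;
      case: (lr j).
  (* Dividing the exponents by p lowers only positive degrees; a constant monomial stays below the
     degree of [q] thanks to [m]. *)
  have [E|dpos] := posnP (mdeg (rt (mon j))).
    rewrite E; have := msize_mdeg_lt mq; rewrite (mpolySpred mdeg q0) ltnS.
    by apply: leq_trans; rewrite lt0n mdeg_eq0.
  have := msize_mdeg_lt (monq j); rewrite (mpolySpred mdeg q0) ltnS.
  by apply: leq_trans; rewrite -{2}(rtK _ (monq j)) mdegMn ltn_Pmulr.
Qed.

(* A relation of minimal degree works: if its partial derivative in the second
   variable vanishes at [x], so does the one in the first, by differentiating the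
   relation; by minimality both are zero, and then it has a p-th root. *)
Lemma separating_relation (x : 'I_2 -> L) (q : {mpoly K[2]}) :
  fr_deriv (x ord0) != 0 -> q != 0 -> mmap lcst x q = 0 ->
  exists r : {mpoly K[2]},
    mmap lcst x r = 0 /\ mmap lcst x (mderiv ord_max r) != 0.
Proof.
move=> x0; have [N] := ubnP (msize q); elim: N q => // N IHN q qN q0 qx.
have [qZ|] := eqVneq (mmap lcst x (mderiv ord_max q)) 0; last by exists q.
have := deriv_mmap x q (@fr_derivD K) (@fr_derivM K) (@fr_derivC K).
have D0 : fr_deriv (0 : L) = 0 by rewrite -{1}(rmorph0 lcst) fr_derivC.
rewrite qx D0 big_ord_recl big_ord1.
have -> : lift ord0 ord0 = ord_max :> 'I_2 by apply: val_inj.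
rewrite qZ mul0r addr0 => /esym/eqP;
  rewrite mulf_eq0 (negPf x0) orbF => /eqP qT.
have [|/forallNP q'0] := pselect (exists k, mderiv k q != 0).
  move=> [k qk]; apply: (IHN (mderiv k q)) => //.
    by rewrite -ltnS (leq_trans _ qN) // ltnS msize_mderiv.
  have [->//|] := eqVneq k ord0; case: k {qk} => [[|[|]]] //= k2 _.
  by rewrite (_ : Ordinal k2 = ord_max) //; apply: val_inj.
have [|r [r0 rx rq]] := mpoly_pth_root q0 qx.
  by move=> k; apply/eqP/negP => /negP/(q'0 k).
by apply: (IHN r) => //; rewrite -ltnS (leq_trans _ qN).
Qed.

End SeparatingRelation.

(** * Algebraic dependence *)

(** Equality of the kernels makes [phi a / phi b] independent of the representation of z and keeps
    its denominator nonzero. *)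
Lemma extend_to_fractions (A : comNzRingType) (F L : fieldType)
    (e : {rmorphism A -> F}) (phi : {rmorphism A -> L}) :
  (forall z, exists a b, e b != 0 /\ z = e a / e b) ->
  (forall a, (phi a == 0) = (e a == 0)) ->
  exists s : {rmorphism F -> L}, forall a, s (e a) = phi a.
Proof.
move=> frac ker.
have eq_phi a b : e a = e b -> phi a = phi b.
  move/eqP; rewrite -subr_eq0 -rmorphB -ker rmorphB subr_eq0.
  by move=> /eqP.
have /choice [s0 s0P] : forall z, exists w, forall a b, e b != 0 ->
    z = e a / e b -> w = phi a / phi b.
  move=> z; have [a [b [b0 zE]]] := frac z; exists (phi a / phi b) => a' b' b'0.
  rewrite zE => /eqP; rewrite eqr_div // -!rmorphM => /eqP /eq_phi.
  rewrite !rmorphM => E; apply/eqP; rewrite eqr_div ?ker //; exact/eqP.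
have s0E a b : e b != 0 -> s0 (e a / e b) = phi a / phi b.
  by move=> b0; apply: (s0P _ a b).
have s0B : zmod_morphism s0.
  move=> x y; have [a [b [b0 ->]]] := frac x; have [c [d [d0 ->]]] := frac y.
  have -> : e a / e b - e c / e d = e (a * d - c * b) / e (b * d).
    by rewrite rmorphB !rmorphM /=; field; rewrite ?b0 ?d0.
  rewrite !s0E ?rmorphM ?mulf_neq0 // rmorphB !rmorphM; field.
  by rewrite !ker b0 d0.
have s0M : monoid_morphism s0.
  split=> [|x y].
    have -> : 1 = e 1 / e 1 by rewrite rmorph1 divr1.
    by rewrite s0E ?rmorph1 ?divr1 ?oner_eq0.
  have [a [b [b0 ->]]] := frac x; have [c [d [d0 ->]]] := frac y.
  have -> : e a / e b * (e c / e d) = e (a * c) / e (b * d).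
    by rewrite !rmorphM /=; field; rewrite ?b0 ?d0.
  by rewrite !s0E ?rmorphM ?mulf_neq0 // mulf_div.
pose zM := GRing.isZmodMorphism.Build F L s0 s0B.
pose mM := GRing.isMonoidMorphism.Build F L s0 s0M.
pose s : {rmorphism F -> L} := HB.pack s0 zM mM.
exists s => a; have -> : e a = e a / e 1 by rewrite rmorph1 divr1.
by rewrite /= s0E ?rmorph1 ?divr1 ?oner_eq0.
Qed.

Definition point2 (T : Type) (a b : T) (k : 'I_2) := if k == ord0 then a else b.

Lemma point2_comp (T U : Type) (f : T -> U) a b :
  f \o point2 a b =1 point2 (f a) (f b).
Proof. by move=> k; rewrite /= /point2; case: ifP. Qed.

Lemma point2P (T : Type) (x : 'I_2 -> T) : x =1 point2 (x ord0) (x ord_max).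
Proof.
move=> k; rewrite /point2; case: eqP => [->//|]; case: k => [[|[|]]] //= k1 k0.
  by case: k0; apply: val_inj.
by congr x; apply: val_inj.
Qed.

Section TwoVariables.
Variable K : fieldType.

Section Ring.
Variables (A : comNzRingType) (i : {rmorphism K -> A}).

Definition ev1 (a : A) : {poly K} -> A := horner_eval a \o map_poly i.
HB.instance Definition _ a := GRing.RMorphism.on (ev1 a).

(** Bivariate polynomials are read as K[X][Y]: the inner variable goes to [a], the outer one to
    [b]. *)
Definition ev2 (a b : A) : {poly {poly K}} -> A :=
  horner_eval b \o map_poly (ev1 a).
HB.instance Definition _ a b := GRing.RMorphism.on (ev2 a b).

Lemma ev1C a c : ev1 a c%:P = i c.
Proof. by rewrite /ev1 /= map_polyC /horner_eval hornerC. Qed.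
Lemma ev1X a : ev1 a 'X = a.
Proof. by rewrite /ev1 /= map_polyX /horner_eval hornerX. Qed.
Lemma ev2C a b p : ev2 a b p%:P = ev1 a p.
Proof. by rewrite /ev2 /= map_polyC /horner_eval hornerC. Qed.
Lemma ev2X a b : ev2 a b 'X = b.
Proof. by rewrite /ev2 /= map_polyX /horner_eval hornerX. Qed.

End Ring.

Lemma rmorph_ev1 (A B : comNzRingType) (i : {rmorphism K -> A})
    (j : {rmorphism K -> B}) (s : {rmorphism A -> B}) a p :
  s \o i =1 j -> s (ev1 i a p) = ev1 j (s a) p.
Proof.
move=> sij; rewrite /ev1 /= /horner_eval -horner_map -map_poly_comp.
by rewrite (eq_map_poly sij).
Qed.

Lemma rmorph_ev2 (A B : comNzRingType) (i : {rmorphism K -> A})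
    (j : {rmorphism K -> B}) (s : {rmorphism A -> B}) a b q :
  s \o i =1 j -> s (ev2 i a b q) = ev2 j (s a) (s b) q.
Proof.
move=> sij; rewrite /ev2 /= /horner_eval -horner_map -map_poly_comp.
congr (_.[_]); apply: eq_map_poly => p /=; exact: rmorph_ev1.
Qed.

Lemma mmap_ev1 (A : comNzRingType) (i : {rmorphism K -> A}) n (x : 'I_n -> A) f
  p :
  mmap i x (ev1 (@mpolyC n K) f p) = ev1 i (mmap i x f) p.
Proof. by apply: rmorph_ev1 => c; apply: mmap_polyC. Qed.

Lemma mmap_ev2 (A : comNzRingType) (i : {rmorphism K -> A}) n (x : 'I_n -> A) f
  g p :
  mmap i x (ev2 (@mpolyC n K) f g p) = ev2 i (mmap i x f) (mmap i x g) p.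
Proof. by apply: rmorph_ev2 => c; apply: mmap_polyC. Qed.

Definition polyCC : K -> {poly {poly K}} := polyC \o polyC.
HB.instance Definition _ := GRing.RMorphism.on polyCC.

Definition to_pp : {mpoly K[2]} -> {poly {poly K}} :=
  mmap polyCC (point2 'X%:P 'X).
HB.instance Definition _ := GRing.RMorphism.on to_pp.

Definition of_pp : {poly {poly K}} -> {mpoly K[2]} :=
  ev2 (@mpolyC 2 K) 'X_ord0 'X_ord_max.
HB.instance Definition _ := GRing.RMorphism.on of_pp.

Lemma ev1_polyCC p : ev1 polyCC 'X%:P p = p%:P.
Proof.
rewrite /ev1 /= /polyCC map_poly_comp /horner_eval horner_map /=.
by rewrite -/(comp_poly 'X p) comp_polyXr.
Qed.

Lemma ev2_polyCC q : ev2 polyCC 'X%:P 'X q = q.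
Proof.
rewrite /ev2 /= (eq_map_poly ev1_polyCC) /horner_eval.
by rewrite -/(comp_poly 'X q) comp_polyXr.
Qed.

Lemma ev2_to_pp (A : comNzRingType) (i : {rmorphism K -> A}) a b q :
  ev2 i a b (to_pp q) = mmap i (point2 a b) q.
Proof.
rewrite /to_pp rmorph_mmap; apply: eq_mmap => [c|k] /=.
  by rewrite ev2C ev1C.
by rewrite /point2; case: ifP => _; rewrite ?ev2X // ev2C ev1X.
Qed.

Lemma mmap_of_pp (A : comNzRingType) (i : {rmorphism K -> A}) a b q :
  mmap i (point2 a b) (of_pp q) = ev2 i a b q.
Proof.
rewrite /of_pp (rmorph_ev2 (j := i)) => [|c] /=; first by rewrite !mmapXU.
by rewrite mmap_polyC.
Qed.

Lemma of_ppK : cancel of_pp to_pp.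
Proof. by move=> q; rewrite -[RHS]ev2_polyCC /to_pp mmap_of_pp. Qed.

Lemma to_ppK : cancel to_pp of_pp.
Proof.
move=> q; rewrite /of_pp ev2_to_pp -[RHS](comp_mpoly_id q);
  apply: eq_mmap => // k.
rewrite tnth_mktuple -(point2P (fun k => 'X_k)) //.
Qed.

Lemma of_pp_eq0 q : (of_pp q == 0) = (q == 0).
Proof. by rewrite -(can_eq of_ppK) rmorph0. Qed.

Lemma to_pp_eq0 q : (to_pp q == 0) = (q == 0).
Proof. by rewrite -(can_eq to_ppK) rmorph0. Qed.

Lemma to_pp_deriv q : (to_pp q)^`() = to_pp (mderiv ord_max q).
Proof.
rewrite /to_pp (deriv_mmap (D := @deriv _)); first last.
- by move=> c; rewrite /polyCC /= derivC.
- by move=> a b; rewrite derivM.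
- by move=> a b; rewrite derivD.
rewrite big_ord_recl big_ord1 /point2 /= derivC mulr0 add0r.
by rewrite derivX mulr1; congr (mmap _ _ (mderiv _ _)); apply: val_inj.
Qed.

Section AlgebraicDependence.
Variables (L : fieldType) (i : {rmorphism K -> L}).

(** Symmetric in [a] and [b]. For [a] transcendental it means that [b] is algebraic over K(a), as
    [transc_algebraic] shows. *)
Definition algdep (a b : L) :=
  exists q : {mpoly K[2]}, q != 0 /\ mmap i (point2 a b) q = 0.

Lemma algdepP a b :
  algdep a b <-> exists q : {poly {poly K}}, q != 0 /\ ev2 i a b q = 0.
Proof.
split=> -[q [q0 qab]].
  by exists (to_pp q); rewrite to_pp_eq0 ev2_to_pp.
by exists (of_pp q); rewrite of_pp_eq0 mmap_of_pp.
Qed.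

Lemma algdep_sym a b : algdep a b -> algdep b a.
Proof.
move=> [q [q0 qab]]; pose sw := [tuple 'X_(rev_ord k) | k < 2] : 2.-tuple {mpoly
  K[2]}.
have swK : cancel (comp_mpoly sw) (comp_mpoly sw).
  move=> p; rewrite {1}/comp_mpoly rmorph_mmap -[RHS](comp_mpoly_id p).
  apply: eq_mmap => [c|k] /=; first by rewrite mmap_polyC.
  by rewrite !tnth_mktuple mmapXU tnth_mktuple rev_ordK.
exists (q \mPo sw); split; first by rewrite -(can_eq swK) swK raddf0.
rewrite mmap_comp_mpoly -[RHS]qab; apply: eq_mmap => // k.
by rewrite tnth_mktuple mmapXU /point2; case: k => [[|[|]]].
Qed.

Definition transc (t : L) := forall p : {poly K}, ev1 i t p = 0 -> p = 0.

(** Evaluation at a transcendental [t] is injective, hence extends to K(t); clearing denominators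
    passes from K(t)[Y] to K[t][Y]. The closure properties of algebraic elements become
    available. *)
Lemma transc_algebraic t : transc t ->
  exists s : {rmorphism {fraction {poly K}} -> L},
    (forall p, s p%:F = ev1 i t p) /\
    forall z, algdep t z <-> algebraicOver s z.
Proof.
move=> tT.
have [||s sE] := @extend_to_fractions {poly K} {fraction {poly K}} L
    (@FracField.tofrac _) (ev1 i t).
- by move=> z; have [n [d [d0 ->]]] := fracP z; exists n, d; rewrite tofrac_eq0.
- move=> p; rewrite tofrac_eq0; apply/eqP/eqP => [/tT //|->].
  by rewrite rmorph0.
exists s; split=> // z; rewrite algdepP; split=> [[q [q0 qz]]|[p p0 pz]].
  exists (map_poly (@FracField.tofrac _) q).
    by rewrite map_poly_eq0_id0 ?lead_coef_eq0 // tofrac_eq0 lead_coef_eq0.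
  rewrite /root -map_poly_comp (eq_map_poly (g := ev1 i t)) => [|r /=];
    last exact: sE.
  exact/eqP.
have [d [n [d0 pE]]] := common_denominator (fun k : 'I_(size p) => p`_k).
pose q := \poly_(k < size p) (if insub k is Some k' then n k' else 0) : {poly
  {poly K}}.
have qE : d%:F *: p = map_poly (@FracField.tofrac _) q.
  apply/polyP => k; rewrite coefZ coef_map coef_poly.
  case: insubP => [k' _ <-|]; last first.
    by rewrite -leqNgt => pk; rewrite ltnNge pk nth_default //= mulr0 rmorph0.
  by rewrite ltn_ord pE /= mulrC divfK // tofrac_eq0.
have qL : map_poly s (d%:F *: p) = map_poly (ev1 i t) q.
  by rewrite qE -map_poly_comp; apply: eq_map_poly.
exists q; split.
  apply: contraNneq p0 => q0; move/eqP: qE; rewrite q0 rmorph0.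
  by rewrite scaler_eq0 tofrac_eq0 (negPf d0).
rewrite /ev2 /= -qL map_polyZ /horner_eval hornerZ.
by rewrite (rootP pz) mulr0.
Qed.

Lemma algdep_const t c : transc t -> algdep t (i c).
Proof.
move=> /transc_algebraic [s [sE ->]]; have := algebraic_id s (c%:P%:F).
by rewrite sE ev1C.
Qed.

Lemma algdep_add t x y : transc t ->
  algdep t x -> algdep t y -> algdep t (x + y).
Proof.
by move=> /transc_algebraic [s [_ sE]] /sE xs /sE ys; apply/sE/algebraic_add.
Qed.

Lemma algdep_mul t x y : transc t ->
  algdep t x -> algdep t y -> algdep t (x * y).
Proof.
by move=> /transc_algebraic [s [_ sE]] /sE xs /sE ys; apply/sE/algebraic_mul.
Qed.

Lemma algdep_inv t x : transc t -> algdep t x -> algdep t x^-1.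
Proof.
by move=> /transc_algebraic [s [_ sE]] /sE xs; apply/sE/algebraic_inv.
Qed.

Lemma algdep_mmap t n (x : 'I_n -> L) f : transc t ->
  (forall k, algdep t (x k)) -> algdep t (mmap i x f).
Proof.
move=> tT xt; elim/mpoly_ring_ind: f => [c|k|f g ft gt|f g ft gt].
- by rewrite mmap_polyC; apply: algdep_const.
- by rewrite mmapXU.
- by rewrite raddfD; apply: algdep_add.
- by rewrite rmorphM; apply: algdep_mul.
Qed.

Lemma algdep_refl t : algdep t t.
Proof.
apply/algdepP; exists ('X - 'X%:P).
by rewrite polyXsubC_eq0 rmorphB /= ev2X ev2C ev1X subrr.
Qed.

(** If [x] is algebraic over K, its equation is already a relation. Otherwise [t] is algebraic over
    K(x) by symmetry, and [y] is so by transitivity. *)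
Lemma algdep_exchange t x y : transc t ->
  algdep t x -> algdep t y -> algdep x y.
Proof.
move=> tT tx ty; have [xT|] := pselect (transc x); last first.
  move=> /existsNP [p /not_implyP [px /eqP p0]]; apply/algdepP; exists p%:P.
  by rewrite polyC_eq0 ev2C.
have [s [sE sP]] := transc_algebraic xT; apply/sP/integral_algebraic.
have /sP /integral_algebraic ts := algdep_sym tx.
have /algdepP [q [q0 qty]] := ty.
have p0 : map_poly (ev1 i t) q != 0.
  rewrite map_poly_eq0_id0 ?lead_coef_eq0 //.
  by apply/eqP => /tT /eqP; rewrite lead_coef_eq0 (negPf q0).
apply: (integral_root p0); first exact/eqP.
move=> _ /(nthP 0) [k _ <-]; rewrite coef_map.
apply: integral_horner => // _ /(nthP 0) [l _ <-]; rewrite coef_map.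
by have := integral_id s ((q`_k)`_l)%:P%:F; rewrite sE ev1C.
Qed.

(** The relation is divided by its outer variable until its constant term b is nonzero; then b(t) is
    a multiple of [z]. This controls the zeros of [z] by those of a polynomial in t. *)
Lemma algdep_divides_poly t z : algdep t z -> z != 0 ->
  exists (b : {poly K}) (g : {poly {poly K}}),
    b != 0 /\ ev1 i t b = z * ev2 i t z g.
Proof.
move=> /algdepP [q [q0 qz]] z0; have [N] := ubnP (size q).
elim: N q q0 qz => // N IHN q q0 qz qN.
have qE : q = drop_poly 1 q * 'X + (q`_0)%:P.
  rewrite -[LHS](poly_take_drop 1) addrC; congr (_ + _).
  by apply/polyP => k; rewrite coef_take_poly coefC; case: k.
have [b0|b0] := eqVneq q`_0 0; last first.
  exists (q`_0), (- drop_poly 1 q); split=> //.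
  move: qz; rewrite {1}qE rmorphD rmorphM /= ev2X ev2C => /eqP.
  by rewrite addrC addr_eq0 => /eqP ->; rewrite rmorphN mulrN mulrC.
have d0 : drop_poly 1 q != 0.
  by apply: contraNneq q0 => d0; rewrite qE d0 b0 mul0r polyC0 addr0.
apply: (IHN (drop_poly 1 q)) => //.
  move: qz; rewrite {1}qE b0 polyC0 addr0 rmorphM /= ev2X => /eqP.
  by rewrite mulf_eq0 (negPf z0) orbF => /eqP.
rewrite size_drop_poly subn1; apply: (@leq_trans (size q));
  last by rewrite -ltnS.
by rewrite ltn_predL size_poly_gt0.
Qed.

End AlgebraicDependence.
End TwoVariables.

(** * Algebraic power series *)

Lemma poly_taylor2 (A : comNzRingType) (p : {poly A}) (y : A) :
  exists G, p = p.[y]%:P + p^`().[y]%:P * ('X - y%:P) + G * (('X - y%:P) * ('X -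
    y%:P)).
Proof.
have /factor_theorem [p1 p1E] : root (p - p.[y]%:P) y.
  by rewrite /root hornerD hornerN hornerC subrr.
have /factor_theorem [G GE] : root (p1 - p1.[y]%:P) y.
  by rewrite /root hornerD hornerN hornerC subrr.
have -> : p^`() = (p1 * ('X - y%:P))^`() by rewrite -p1E derivB derivC subr0.
exists G; rewrite derivM derivXsubC mulr1 hornerD hornerM hornerXsubC subrr
  mulr0 add0r.
rewrite mulrA -GE mulrBl -p1E.
by ring.
Qed.

Section SimpleTail.
Variable K : fieldType.
Local Notation R := (pseries K).
Local Notation L := {fraction pseries K}.
Local Notation lcst := (@lcst K).
Local Notation t := (psX K).

Lemma ev1_psX p : ev1 (@psC K) t p = ps_of_poly p.
Proof.
rewrite -[RHS](congr1 (@ps_of_poly K) (comp_polyXr p)) /ev1 /= /horner_eval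
  /psC.
by rewrite map_poly_comp horner_map /=.
Qed.

Lemma ev2_psX w q : ev2 (@psC K) t w q = (map_poly (@ps_of_poly K) q).[w].
Proof. by rewrite /ev2 /= /horner_eval (eq_map_poly ev1_psX). Qed.

Lemma ev2_tofrac (x y : R) q : ev2 lcst x%:F y%:F q = (ev2 (@psC K) x y q)%:F.
Proof. by apply/esym/rmorph_ev2. Qed.

Lemma ev1_tofrac (x : R) q : ev1 lcst x%:F q = (ev1 (@psC K) x q)%:F.
Proof. by apply/esym/rmorph_ev1. Qed.

Lemma transc_psX : transc lcst t%:F.
Proof.
move=> p; rewrite ev1_tofrac ev1_psX => /eqP; rewrite tofrac_eq0 => /eqP p0.
by apply: (@ps_of_poly_inj K); rewrite p0 rmorph0.
Qed.

Definition algebraic_series (y : R) := algdep lcst t%:F y%:F.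

Lemma algebraic_series_divides_poly (y : R) : algebraic_series y -> y != 0 ->
  exists (b : {poly K}) (g : {poly {poly K}}),
    b != 0 /\ ev1 (@psC K) t b = y * ev2 (@psC K) t y g.
Proof.
rewrite -tofrac_eq0 => yalg y0.
have [b [g [b0]]] := algdep_divides_poly yalg y0.
rewrite ev1_tofrac ev2_tofrac -tofracM => /eqP; rewrite tofrac_eq => /eqP bE.
by exists b, g.
Qed.

Lemma algebraic_series_mmap n (y : 'I_n -> R) f :
  (forall k, algebraic_series (y k)) -> algebraic_series (mmap (@psC K) y f).
Proof.
move=> yalg; rewrite /algebraic_series (rmorph_mmap (@FracField.tofrac R)).
by apply: algdep_mmap => [|j]; [exact: transc_psX | exact: yalg].
Qed.

Lemma separable_algebraic_series (y : R) : algebraic_series y ->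
  exists q : {poly {poly K}},
    ev2 (@psC K) t y q = 0 /\ ev2 (@psC K) t y q^`() != 0.
Proof.
move=> [q [q0 qy]].
have [|r [ry r'y]] := separating_relation (x := point2 t%:F y%:F) _ q0 qy.
  by rewrite fr_derivF ps_derivX tofrac_eq0 oner_neq0.
exists (to_pp r); split.
  by apply/eqP; rewrite -tofrac_eq0 -ev2_tofrac ev2_to_pp ry.
by rewrite -tofrac_eq0 -ev2_tofrac to_pp_deriv ev2_to_pp.
Qed.

(* If the derivative of a relation q of y has order v at y, then substituting
   P + t^(v+1) W for y and dividing by t^(2v+1) gives, modulo t, a polynomial of
   degree 1 in W. *)
Lemma simple_tail (y : R) : algebraic_series y ->
  exists (N : nat) (P : {poly K}) (w : R) (q : {poly {poly K}}),
    [/\ y = ps_of_poly P + t ^+ N * w, ev2 (@psC K) t w q = 0 &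
        pcoef (ev2 (@psC K) t w q^`()) 0 != 0].
Proof.
move=> /separable_algebraic_series [Q []]; rewrite !ev2_psX -deriv_map.
set QR := map_poly _ Q => Qy /ps_order [v [u [QvE u0]]].
pose N := v.+1; pose P := ps_trunc N y; pose w := ps_tail N y.
have yE : y = ps_of_poly P + t ^+ N * w by exact: ps_trunc_tail.
pose Q2 := Q \Po (P%:P + ('X^N)%:P * 'X).
have [G QG] := poly_taylor2 QR y.
pose G2 := G \Po ((ps_of_poly P)%:P + (t ^+ N)%:P * 'X).
(* This is the Taylor expansion at [y] divided by t^(N+v); since 2 N = (N + v) + 1, the quadratic
   term keeps one factor t. *)
pose H := u%:P * ('X - w%:P) + t%:P * (G2 * (('X - w%:P) * ('X - w%:P))).
have Q2E : map_poly (@ps_of_poly K) Q2 = (t ^+ (N + v))%:P * H.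
  rewrite /Q2 map_comp_poly -/QR rmorphD rmorphM /= !map_polyC map_polyX /=.
  rewrite [in LHS]rmorphXn /= -/(psX K) QG Qy QvE add0r rmorphD !rmorphM /=
    -/G2.
  rewrite [RHS]mulrDr rmorphB /= !comp_polyC comp_polyX.
  have -> : (ps_of_poly P)%:P + (t ^+ N)%:P * 'X - y%:P = (t ^+ N)%:P * ('X -
    w%:P).
    by rewrite {1}yE rmorphD rmorphM /=; ring.
  congr (_ + _); first by rewrite exprD rmorphM; ring.
  rewrite exprD rmorphM /= /N exprS rmorphM /=; ring.
(* The coefficients of [Q2] lie in K[t] and are divisible by t^(N+v), so the quotient is again
   defined over K[t]. *)
pose q := map_poly (drop_poly (N + v)) Q2.
have qE : map_poly (@ps_of_poly K) q = H.
  apply/polyP => k; rewrite coef_map coef_map_id0 ?raddf0 //.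
  apply: psP => n; rewrite /= coef_drop_poly.
  have /polyP /(_ k) := Q2E; rewrite coef_map mul_polyC coefZ => E.
  have := congr1 (fun f : R => pcoef f (n + (N + v))) E.
  rewrite pcoefXnM ltnNge leq_addl /= addnK => <- //.
exists N, P, w, q; split=> //; rewrite ev2_psX.
  by rewrite qE !(hornerXsubC, hornerM, hornerD) subrr !mulr0 addr0.
rewrite -deriv_map qE /H derivD !derivM !derivC !mul0r !add0r derivXsubC mulr1.
rewrite !(derivM, derivXsubC, hornerXsubC, hornerC, hornerM, hornerD).
by rewrite subrr !(mulr0, mul0r, addr0).
Qed.

End SimpleTail.

(** * Subfields generated by finitely many elements *)

Local Open Scope classical_set_scope.

Section GeneratedSubfield.
Variables (K E : fieldType) (iota : {rmorphism K -> E}) (m : nat).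
Variable x : 'I_m -> E.

Definition gen_pred : {pred E} := fun z => `[< gen_field iota x z >].

Lemma gen_predP z : reflect (gen_field iota x z) (z \in gen_pred).
Proof. exact: asboolP. Qed.

Lemma evalF_gen_pred f : evalF iota x f \in gen_pred.
Proof.
apply/gen_predP; exists f, 1; rewrite /evalF !rmorph1 oner_eq0.
by rewrite divr1.
Qed.

Lemma gen_pred_divring : divring_closed gen_pred.
Proof.
split; first by have := evalF_gen_pred 1; rewrite /evalF rmorph1.
- move=> _ _ /gen_predP [f [g [g0 ->]]] /gen_predP [f' [g' [g'0 ->]]].
  apply/gen_predP; exists (f * g' - f' * g), (g * g').
  move: g0 g'0; rewrite /evalF rmorphB !rmorphM /= => g0 g'0.
  rewrite mulf_neq0 //; split=> //.
  by rewrite -[in RHS]mulNr -addf_div // mulNr.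
- move=> _ _ /gen_predP [f [g [g0 ->]]] /gen_predP [f' [g' [g'0 ->]]].
  apply/gen_predP; have [->|f'0] := eqVneq (evalF iota x f') 0.
    exists 0, 1; rewrite /evalF !rmorph1 rmorph0 oner_eq0.
    by rewrite mul0r invr0 mulr0 mul0r.
  exists (f * g'), (g * f').
  move: g0 g'0 f'0; rewrite /evalF !rmorphM /= => g0 g'0 f'0.
  rewrite mulf_neq0 //; split=> //.
  by rewrite invf_div mulf_div.
Qed.

HB.instance Definition _ := GRing.isDivringClosed.Build E gen_pred
  gen_pred_divring.

(** K(x) as a field of its own, because the coordinates of a chart of a [curve] must generate the
    whole function field. *)
Record subfield_gen := SubfieldGen { sval_gen : E; _ : sval_gen \in gen_pred }.

HB.instance Definition _ := [isSub for sval_gen].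
HB.instance Definition _ := [Choice of subfield_gen by <:].
HB.instance Definition _ := [SubChoice_isSubIntegralDomain of subfield_gen by
  <:].
HB.instance Definition _ := [SubIntegralDomain_isSubField of subfield_gen by
  <:].

Lemma iota_gen_pred c : iota c \in gen_pred.
Proof. by have := evalF_gen_pred c%:MP; rewrite /evalF mmap_polyC. Qed.

Definition gen_cst (c : K) : subfield_gen := SubfieldGen (iota_gen_pred c).

Lemma gen_cst_zmod : zmod_morphism gen_cst.
Proof. by move=> a b; apply: val_inj; rewrite /= rmorphB. Qed.
Lemma gen_cst_monoid : monoid_morphism gen_cst.
Proof. by split=> [|a b]; apply: val_inj; rewrite /= ?rmorph1 ?rmorphM. Qed.

HB.instance Definition _ := GRing.isZmodMorphism.Build K subfield_gen gen_cst
  gen_cst_zmod.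
HB.instance Definition _ := GRing.isMonoidMorphism.Build K subfield_gen gen_cst
  gen_cst_monoid.

Lemma coord_gen_pred j : x j \in gen_pred.
Proof. by have := evalF_gen_pred 'X_j; rewrite /evalF mmapXU. Qed.

Definition gen_coord j : subfield_gen := SubfieldGen (coord_gen_pred j).

Lemma val_evalF_gen f : val (evalF gen_cst gen_coord f) = evalF iota x f.
Proof. by rewrite /evalF (rmorph_mmap val). Qed.

Lemma evalF_gen_eq0 f : (evalF gen_cst gen_coord f == 0) = (evalF iota x f ==
  0).
Proof. by rewrite -val_evalF_gen -(inj_eq val_inj). Qed.

Lemma gen_field_gen_coord : gen_field gen_cst gen_coord = setT.
Proof.
apply/seteqP; split=> // z _; have /gen_predP [f [g [g0 zE]]] := valP z.
exists f, g; rewrite evalF_gen_eq0; split=> //.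
by apply: val_inj; rewrite rmorphM fmorphV /= !val_evalF_gen.
Qed.

End GeneratedSubfield.

(** * Affine curves with a generic point in K[[t]] *)

Section MapSeries.
Variables (K L : fieldType) (j : {rmorphism K -> L}).

Definition ps_map (f : pseries K) : pseries L := PSeries (fun n => j (pcoef f
  n)).

Lemma ps_map_zmod : zmod_morphism ps_map.
Proof. by move=> f g; apply: psP => n; rewrite /= rmorphB. Qed.

Lemma ps_map_monoid : monoid_morphism ps_map.
Proof.
split=> [|f g]; apply: psP => n; first by rewrite /= !coef1 rmorph_nat.
by rewrite /= rmorph_sum; apply: eq_bigr => i _; rewrite rmorphM.
Qed.

HB.instance Definition _ := GRing.isZmodMorphism.Build (pseries K) (pseries L)
  ps_map ps_map_zmod.
HB.instance Definition _ := GRing.isMonoidMorphism.Build (pseries K) (pseries L)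
  ps_map ps_map_monoid.

Lemma ps_mapC c : ps_map (psC c) = psC (j c).
Proof. by apply: psP => n; rewrite /= !coefC; case: ifP; rewrite ?rmorph0. Qed.

End MapSeries.

Section SeriesPoint.
Variables (K : fieldType) (m : nat) (y : 'I_m -> pseries K).
Local Notation R := (pseries K).
Local Notation L := {fraction pseries K}.
Local Notation lcst := (@lcst K).
Local Notation t := (psX K).

Definition frac_point j : L := (y j)%:F.
Local Notation cst_y := (gen_cst lcst frac_point).
Local Notation coord_y := (gen_coord lcst frac_point).

Lemma mmap_frac_point f : mmap lcst frac_point f = (mmap (@psC K) y f)%:F.
Proof. by rewrite (rmorph_mmap (@FracField.tofrac R)). Qed.

Lemma evalF_series_eq0 f :
  (evalF cst_y coord_y f == 0) = (mmap (@psC K) y f == 0).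
Proof. by rewrite evalF_gen_eq0 /evalF mmap_frac_point tofrac_eq0. Qed.

Lemma vanishing_seriesE f :
  (f \in vanishing cst_y coord_y) = (mmap (@psC K) y f == 0).
Proof. by rewrite inE evalF_series_eq0. Qed.

(** Read coefficientwise in t, g(y) = 0 is a family of linear relations over E between the
    coefficients of monomials in [y], which descend to K. Geometric integrality follows since E[[t]]
    is a domain. *)
Lemma base_change_series (E : fieldType) (j : {rmorphism K -> E}) g :
  base_change j (vanishing cst_y coord_y) g <->
  mmap (@psC E) (ps_map j \o y) g = 0.
Proof.
have mmapj f : mmap (@psC E) (ps_map j \o y) (map_mpoly j f) = ps_map j (mmap
  (@psC K) y f).
  rewrite rmorph_mmap /map_mpoly rmorph_mmap; apply: eq_mmap => k /=.
    by rewrite mmap_polyC ps_mapC.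
  by rewrite mmapXU.
split=> [[s [sI ->]]|gy].
  rewrite rmorph_sum /= big_seq big1 // => x /sI.
  by rewrite vanishing_seriesE => /eqP x0;
    rewrite rmorphM /= mmapj x0 rmorph0 mulr0.
pose s := size (msupp g); pose mon (k : 'I_s) := nth 0%MM (msupp g) k.
have gE (A : nmodType) (F : 'X_{1..m} -> A) :
    \sum_(l <- msupp g) F l = \sum_k F (mon k).
  by rewrite (big_nth 0%MM) big_mkord.
have [n|B [[h gh] By]] := linear_relations_descend (j := j)
    (u := fun k => pcoef (mmap1 y (mon k))) (g := \row_k g@_(mon k)).
  rewrite -[RHS](pcoef_0 E n) -gy /mmap gE pcoef_sum; apply: eq_bigr => k _.
  rewrite mxE pcoefCM; congr (_ * _);
    rewrite -[LHS]/(pcoef (ps_map j (mmap1 y (mon k))) n).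
  by rewrite rmorph_prod; congr (pcoef _ n); apply: eq_bigr => i _;
    rewrite rmorphXn.
pose hk k := \sum_i B k i *: 'X_[mon i] : {mpoly K[m]}.
exists [seq ((h 0 k)%:MP, hk k) | k : 'I_s]; split.
  move=> _ /mapP [k _ ->]; rewrite /= vanishing_seriesE /hk rmorph_sum /=.
  apply/eqP/psP => n; rewrite pcoef_sum pcoef_0 -[RHS](By k n).
  by apply: eq_bigr => i _; rewrite mmapZ mmapX pcoefCM.
rewrite big_map big_enum /= {1}(mpolyE g) gE.
under [RHS]eq_bigr => k _ do rewrite /hk rmorph_sum mulr_sumr /=.
rewrite exchange_big /=; apply: eq_bigr => i _.
have /rowP /(_ i) := gh; rewrite !mxE => ->.
rewrite scaler_suml; apply: eq_bigr => k _.
by rewrite mxE map_mpolyZ map_mpolyX mul_mpolyC scalerA.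
Qed.

Lemma vanishing_series_ideal : idealr_closed (vanishing cst_y coord_y).
Proof.
split; first by rewrite vanishing_seriesE rmorph0.
  by rewrite vanishing_seriesE rmorph1 oner_eq0.
move=> a f g; rewrite !vanishing_seriesE => /eqP f0 /eqP g0.
by rewrite rmorphD rmorphM /= f0 g0 mulr0 addr0.
Qed.

Lemma radical_base_change_series (E : fieldType) (j : {rmorphism K -> E}) g :
  radical (base_change j (vanishing cst_y coord_y)) g <->
  mmap (@psC E) (ps_map j \o y) g = 0.
Proof.
split=> [[k /base_change_series]|gy]; last first.
  by exists 1%N; rewrite expr1; apply/base_change_series.
by rewrite rmorphXn /= => /eqP; rewrite expf_eq0 => /andP [_ /eqP].
Qed.

(** The dimension is 1 because t is a transcendental coordinate and all coordinates are algebraic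
    over K(t), so that any two functions satisfy a relation. *)
Lemma affine_curve_series (j0 : 'I_m) : y j0 = t ->
  (forall j, algebraic_series (y j)) ->
  affine_curve (vanishing cst_y coord_y).
Proof.
move=> yj0 yalg; split.
- exact: vanishing_series_ideal.
- move=> E j; split=> [/radical_base_change_series|f g].
    by rewrite rmorph1 => /eqP; rewrite oner_eq0.
  move=> /radical_base_change_series; rewrite rmorphM /= => /eqP.
  by rewrite mulf_eq0 => /orP [] /eqP; [left | right];
    apply/radical_base_change_series.
- by move=> E j g /radical_base_change_series g0; apply/base_change_series.
split.
  exists [tuple 'X_j0] => p; rewrite vanishing_seriesE mmap_comp_mpoly => p0.
  have p1 : ev1 lcst t%:F (mmap polyC (fun=> 'X) p) = 0.
    apply/eqP; rewrite ev1_tofrac tofrac_eq0 rmorph_mmap.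
    rewrite (eq_mmap (j := @psC K) (y := fun l => mmap (@psC K) y (tnth [tuple
      'X_j0] l))) //.
      by move=> c /=; rewrite ev1C.
    by move=> k /=; rewrite [k]ord1 tnth0 mmapXU yj0 ev1X.
  have := transc_psX p1 => p1_0.
  rewrite -(comp_mpoly_id p).
  transitivity (ev1 (@mpolyC 1 K) 'X_ord0 (mmap polyC (fun=> 'X) p));
    last first.
    by rewrite p1_0 rmorph0.
  rewrite rmorph_mmap; apply: eq_mmap => k /=; first by rewrite ev1C.
  by rewrite tnth_mktuple ev1X [k]ord1.
move=> f fI.
have alg k : algdep lcst t%:F (mmap lcst frac_point (tnth f k)).
  by apply: algdep_mmap => [|j]; [exact: transc_psX | exact: yalg].
have [q [q0 qf]] := algdep_exchange (@transc_psX K) (alg ord0) (alg ord_max).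
case/eqP: q0; apply: fI; rewrite vanishing_seriesE -tofrac_eq0 -mmap_frac_point.
rewrite mmap_comp_mpoly -qf; apply/eqP/eq_mmap => // k.
exact: (point2P (fun k => mmap lcst frac_point (tnth f k))).
Qed.

End SeriesPoint.

(** * Local rings of an affine chart *)

Section AffineChart.
Variables (K F : fieldType) (iota : {rmorphism K -> F}) (m : nat).
Variable xi : 'I_m -> F.

Lemma evalF_notin P g : prime_of iota xi P -> g \notin P -> evalF iota xi g !=
  0.
Proof. by move=> [_ _ sub]; apply: contraNneq => g0; apply: sub;
  rewrite inE g0. Qed.

Lemma prime_of1 P : prime_of iota xi P -> 1 \notin P.
Proof. by move=> [[_ P1 _] _ _]. Qed.

Lemma prime_of_mulNin P f g : prime_of iota xi P ->
  f \notin P -> g \notin P -> f * g \notin P.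
Proof. by move=> [_ Pp _] fP gP; apply/negP => /Pp;
  rewrite (negPf fP) (negPf gP). Qed.

Lemma localization_evalF P f : prime_of iota xi P ->
  localization iota xi P (evalF iota xi f).
Proof.
move=> PP; exists f, 1; split; first exact: prime_of1 PP.
by rewrite /evalF rmorph1 divr1.
Qed.

Lemma prime_of_congr P f g : prime_of iota xi P ->
  evalF iota xi f = evalF iota xi g -> f \in P -> g \in P.
Proof.
move=> [[P0 _ PI] _ sub] fg fP.
have gfP : g - f \in P by apply: sub;
  rewrite inE /evalF rmorphB /= -/(evalF _ _ _) -fg subrr.
by have := PI 1 f (g - f) fP gfP; rewrite mul1r addrC subrK.
Qed.

Lemma nonunit_evalF P f : prime_of iota xi P ->
  nonunits (localization iota xi P) (evalF iota xi f) <-> f \in P.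
Proof.
move=> PP; split=> [[_ fnu]|fP].
  apply/negPn/negP => fP; have f0 := evalF_notin PP fP.
  apply: (fnu (evalF iota xi f)^-1); last by rewrite mulfV.
  by exists 1, f; rewrite /evalF rmorph1 div1r.
split=> [|_ [a [b [bP ->]]] E]; first exact: localization_evalF.
have b0 := evalF_notin PP bP.
case/negP: bP; apply: (prime_of_congr (f := a * f) PP).
  rewrite /evalF rmorphM /= -/(evalF _ _ _).
  by rewrite -[RHS]mul1r -E mulrC mulrA mulfVK // mulrC.
have [[P0 _ PI] _ _] := PP; have := PI a f 0 fP P0.
by rewrite addr0.
Qed.

(** An element of [P] outside [Q] would be a unit in the local ring at [Q], hence in [D], and a
    nonunit of [D] by domination from [P]. Affine charts are therefore separated. *)
Lemma dominated_prime_eq (P Q : {pred {mpoly K[m]}}) (D : set F) :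
  prime_of iota xi P -> prime_of iota xi Q ->
  dominates D (localization iota xi P) -> dominates D (localization iota xi Q)
    ->
  {subset P <= Q}.
Proof.
move=> PP QQ [_ PD] [QD _] f fP; apply/negPn/negP => fQ.
have [_ fnu] := PD _ ((nonunit_evalF f PP).2 fP).
have f0 := evalF_notin QQ fQ.
apply: (fnu (evalF iota xi f)^-1); last by rewrite mulfV.
by apply: QD; exists 1, f; rewrite /evalF rmorph1 div1r.
Qed.

End AffineChart.

(** * Rational points *)

Lemma finite_roots (K : fieldType) (p : {poly K}) :
  p != 0 -> finite_set [set a | root p a].
Proof.
move=> p0; apply: contrapT => /(infinite_set_fset (size p)) [X XA pX].
have Xp : all (root p) (finmap.enum_fset X) by apply/allP => a aX; apply: XA.
have := max_poly_roots p0 Xp (finmap.fset_uniq X).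
by rewrite ltnNge pX.
Qed.

Lemma finite_fun_set (m : nat) (T : choiceType) (A : 'I_m -> set T) :
  (forall j, finite_set (A j)) -> finite_set [set c | forall j, A j (c j)].
Proof.
move=> Afin.
have /choice [s sP] : forall j, exists s : seq T, A j = [set` s].
  by move=> j; apply/finite_seqP.
pose S := undup (flatten [seq s j | j : 'I_m]).
apply: (@sub_finite_set _ _
    [set (fun j => val (f j)) | f in [set: {ffun 'I_m -> seq_sub S}]]);
      last first.
  exact/finite_image/finite_finset.
move=> c cA; have cS j : c j \in S.
  rewrite mem_undup; apply/flattenP; exists (s j);
    first by rewrite map_f ?mem_enum.
  by have := cA j; rewrite sP.
exists [ffun j => SeqSub (cS j)] => //.
by apply/funext => j; rewrite ffunE.
Qed.

Section RationalPoint.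
Variables (K F : fieldType) (iota : {rmorphism K -> F}) (m : nat).
Variables (xi : 'I_m -> F).

Definition specializes (c : 'I_m -> K) :=
  forall f, evalF iota xi f = 0 -> meval c f = 0.

Definition point_ideal (c : 'I_m -> K) : {pred {mpoly K[m]}} :=
  fun f => meval c f == 0.

Lemma prime_of_point c : specializes c -> prime_of iota xi (point_ideal c).
Proof.
move=> cP; split.
- split; rewrite ?unfold_in ?meval0 ?meval1 ?oner_eq0 //.
  move=> a f g; rewrite !unfold_in mevalD mevalM => /eqP -> /eqP ->.
  by rewrite mulr0 addr0.
- by move=> f g; rewrite !unfold_in mevalM mulf_eq0.
- by move=> f; rewrite inE => /eqP /cP f0; rewrite unfold_in f0.
Qed.

(** The value of [z] at [c], as a relation: some value exists exactly when [z] lies in the local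
    ring at [c]. *)
Definition residue (c : 'I_m -> K) (z : F) (a : K) :=
  exists f g, [/\ meval c g != 0, z = evalF iota xi f / evalF iota xi g &
                  a = meval c f / meval c g].

Lemma residue_localization c z :
  localization iota xi (point_ideal c) z <-> exists a, residue c z a.
Proof.
split=> [[f [g [g0 ->]]]|[a [f [g [g0 -> _]]]]]; last by exists f, g.
by exists (meval c f / meval c g), f, g.
Qed.

Lemma residue_value c z a : specializes c -> residue c z a ->
  localization iota xi (point_ideal c) z /\
  nonunits (localization iota xi (point_ideal c)) (z - iota a).
Proof.
move=> cP [f [g [g0 -> ->]]]; have PP := prime_of_point cP.
have gF := evalF_notin PP g0.
split; first by exists f, g.
pose h := f - (meval c f / meval c g)%:MP * g.
have hP : h \in point_ideal c.
  by rewrite unfold_in mevalB mevalM mevalC divfK // subrr.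
have [_ nu] := (nonunit_evalF _ PP).2 hP.
have E : evalF iota xi f / evalF iota xi g - iota (meval c f / meval c g) =
    evalF iota xi h / evalF iota xi g.
  have -> : evalF iota xi h =
      evalF iota xi f - iota (meval c f / meval c g) * evalF iota xi g.
    by rewrite /evalF /h rmorphB rmorphM /= mmap_polyC.
  by rewrite mulrBl mulfK.
split; first by rewrite E; exists h, g.
rewrite E => _ [a' [b [b0 ->]]] H; have bF := evalF_notin PP b0.
apply: (nu (evalF iota xi a' / evalF iota xi (g * b))).
  by exists a', (g * b); split=> //; apply: prime_of_mulNin PP _ _.
rewrite -[RHS]H /evalF !rmorphM /= invfM; ring.
Qed.

(** The coordinates of [c] are the residues of the variables; by [mpoly_hadamard], f is congruent to
    f(c) modulo [P], so [P] is the kernel of evaluation at [c]. *)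
Lemma rational_prime P :
  prime_of iota xi P ->
  (forall z, localization iota xi P z ->
     exists a, nonunits (localization iota xi P) (z - iota a)) ->
  exists2 c, specializes c & P = point_ideal c.
Proof.
move=> PP val.
have /choice [c cP] : forall j, exists a, ('X_j - a%:MP : {mpoly K[m]}) \in P.
  move=> j; have [|a aP] := val (xi j).
    by have := localization_evalF 'X_j PP; rewrite /evalF mmapXU.
  exists a; apply/(nonunit_evalF _ PP).
  by rewrite /evalF rmorphB /= mmapXU mmap_polyC.
have [[P0 P1 PI] Pp sub] := PP.
have fc f : f - (meval c f)%:MP \in P.
  have [G [-> _]] := mpoly_hadamard c f.
  apply: (big_ind (fun h => h \in P)) => // [g h gP hP|j _].
    by have := PI 1 g h gP hP; rewrite mul1r.
  by have := PI (G j) _ 0 (cP j) P0; rewrite addr0.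
have PE f : (f \in P) = (meval c f == 0).
  apply/idP/eqP => [fP|f0]; last by have := fc f; rewrite f0 mpolyC0 subr0.
  apply/eqP; apply: contraNT P1 => f0.
  have cfP : (meval c f)%:MP \in P.
    have := PI (-1) _ f (fc f) fP; rewrite mulN1r opprB subrK //.
  have := PI (meval c f)^-1%:MP _ 0 cfP P0.
  by rewrite addr0 -mpolyCM mulVf.
exists c; last by apply/funext => f; exact: PE.
by move=> f f0; apply/eqP; rewrite -PE; apply: sub; rewrite inE f0.
Qed.

End RationalPoint.

Section CurvePoint.
Variables (K : fieldType) (C : curve K) (i : chart C) (c : 'I_(embdim i) -> K).
Hypothesis cP : specializes (cst C) (@coord K C i) c.

Definition curve_point := localization (cst C) (@coord K C i) (point_ideal c).

Lemma residue_has_value z a :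
  residue (cst C) (@coord K C i) c z a -> has_value curve_point z a.
Proof. exact: residue_value. Qed.

Lemma curve_point_rational : rat_points C curve_point.
Proof.
split; first by exists i, (point_ideal c); split=> //; exact: prime_of_point.
move=> z /residue_localization [a za]; exists a; exact: residue_has_value.
Qed.

End CurvePoint.

(** * Etale curves over the line *)

Section ConstantTerm.
Variable K : fieldType.

Definition ps_const (f : pseries K) := pcoef f 0.

Lemma ps_const_zmod : zmod_morphism ps_const.
Proof. by []. Qed.
Lemma ps_const_monoid : monoid_morphism ps_const.
Proof. by split=> [|f g]; rewrite /ps_const ?pcoef_1 ?pcoef0M. Qed.

HB.instance Definition _ := GRing.isZmodMorphism.Build (pseries K) K ps_const
  ps_const_zmod.
HB.instance Definition _ := GRing.isMonoidMorphism.Build (pseries K) K ps_const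
  ps_const_monoid.

Lemma ps_constC c : ps_const (psC c) = c.
Proof. by rewrite /ps_const pcoefC. Qed.

End ConstantTerm.

Lemma deriv_ev2 (K : fieldType) (A : comNzRingType) (i : {rmorphism K -> A})
    (D : A -> A) a b q :
  (forall x y, D (x + y) = D x + D y) ->
  (forall x y, D (x * y) = D x * y + x * D y) ->
  (forall c, D (i c) = 0) -> D a = 0 ->
  D (ev2 i a b q) = ev2 i a b q^`() * D b.
Proof.
move=> DD DM DC Da; rewrite -mmap_of_pp deriv_mmap // big_ord_recl big_ord1.
rewrite /point2 /= Da mulr0 add0r -/(point2 a b); congr (_ * _).
rewrite -[q in RHS]of_ppK to_pp_deriv ev2_to_pp.
by congr (mmap _ _ (mderiv _ _)); apply: val_inj.
Qed.

Section EtaleCurve.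
Variables (K : fieldType) (N : nat).
Local Notation R := (pseries K).
Local Notation t := (psX K).
Local Notation lcst := (@lcst K).
Variables (w : 'I_N -> R) (q : 'I_N -> {poly {poly K}}).
Hypothesis qw : forall k, ev2 (@psC K) t (w k) (q k) = 0.
Hypothesis q'w : forall k, pcoef (ev2 (@psC K) t (w k) (q k)^`()) 0 != 0.

Definition jac := \prod_k ev2 (@psC K) t (w k) (q k)^`().

Lemma jac_unit : jac^-1 * jac = 1.
Proof.
apply: mulVr; rewrite ps_unitE -/(ps_const jac) rmorph_prod.
by apply/prodf_neq0 => k _; apply: q'w.
Qed.

(* The coordinates are t, the w_l and the inverse of the Jacobian, in this
   order. *)
Definition etale_point (j : 'I_N.+2) : R :=
  if unlift ord0 j is Some k then
    (if unlift ord_max k is Some l then w l else jac^-1)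
  else t.

Definition wvar (l : 'I_N) : 'I_N.+2 := lift ord0 (lift ord_max l).
Definition vvar : 'I_N.+2 := lift ord0 ord_max.

Lemma etale_point0 : etale_point ord0 = t.
Proof. by rewrite /etale_point unlift_none. Qed.
Lemma etale_point_w l : etale_point (wvar l) = w l.
Proof. by rewrite /etale_point !liftK. Qed.
Lemma etale_point_v : etale_point vvar = jac^-1.
Proof. by rewrite /etale_point liftK unlift_none. Qed.

Lemma algebraic_w l : algebraic_series (w l).
Proof.
apply/algdepP; exists (q l); split; last by rewrite ev2_tofrac qw rmorph0.
by apply: contraNneq (q'w l) => ->; rewrite deriv0 rmorph0 pcoef_0.
Qed.

Lemma algebraic_etale_point j : algebraic_series (etale_point j).
Proof.
have tT := @transc_psX K.
rewrite /etale_point; case: unliftP => [k|] _; last exact: algdep_refl.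
case: unliftP => [l|] _; first exact: algebraic_w.
have jacV : (jac^-1)%:F = (jac%:F)^-1 :> {fraction R}.
  have jF : jac%:F != 0 :> {fraction R}.
    rewrite tofrac_eq0; apply/eqP => j0; have := jac_unit.
    by rewrite j0 mulr0 => /esym/eqP; rewrite oner_eq0.
  by apply: (mulIf jF); rewrite -rmorphM jac_unit mulVf // rmorph1.
rewrite /algebraic_series jacV; apply: algdep_inv => //.
rewrite rmorph_prod; apply: (big_ind (algdep lcst t%:F)).
- by have := algdep_const 1 tT; rewrite rmorph1.
- by move=> x y; apply: algdep_mul.
move=> l _; rewrite /= -ev2_tofrac -mmap_of_pp; apply: algdep_mmap => // k2.
by rewrite /point2; case: ifP => _; [apply: algdep_refl | apply: algebraic_w].
Qed.

Local Notation X0 := ('X_ord0 : {mpoly K[N.+2]}).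
Local Notation cst_y := (gen_cst lcst (frac_point etale_point)).
Local Notation coord_y := (gen_coord lcst (frac_point etale_point)).

Definition wrel l := ev2 (@mpolyC N.+2 K) X0 'X_(wvar l) (q l).
Definition wrel' l := ev2 (@mpolyC N.+2 K) X0 'X_(wvar l) (q l)^`().
Definition vrel := 'X_vvar * \prod_l wrel' l - 1.

Definition etale_rel (k : 'I_N.+1) : {mpoly K[N.+2]} :=
  if unlift ord_max k is Some l then wrel l else vrel.

Lemma mmap_ev2_wvar l p :
  mmap (@psC K) etale_point (ev2 (@mpolyC N.+2 K) X0 'X_(wvar l) p) =
  ev2 (@psC K) t (w l) p.
Proof.
by rewrite mmap_ev2 !mmapXU etale_point0 etale_point_w.
Qed.

Lemma mmap_prod_wrel' : mmap (@psC K) etale_point (\prod_l wrel' l) = jac.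
Proof. by rewrite rmorph_prod /=; apply: eq_bigr => l _;
  exact: mmap_ev2_wvar. Qed.

Lemma mmap_vrel : mmap (@psC K) etale_point vrel = 0.
Proof.
rewrite rmorphB rmorphM /= mmapXU etale_point_v mmap_prod_wrel' jac_unit.
by rewrite rmorph1 subrr.
Qed.

Lemma etale_rel_vanishing k : etale_rel k \in vanishing cst_y coord_y.
Proof.
rewrite vanishing_seriesE /etale_rel; case: unliftP => [l|] _.
  by rewrite mmap_ev2_wvar qw.
by rewrite mmap_vrel.
Qed.

Lemma mderiv_wvar l k p :
  mderiv (lift ord0 k) (ev2 (@mpolyC N.+2 K) X0 'X_(wvar l) p) =
  ev2 (@mpolyC N.+2 K) X0 'X_(wvar l) p^`() * (lift ord_max l == k)%:R%:MP.
Proof.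
have X0' : mderiv (lift ord0 k) X0 = 0 by rewrite mderivXU mpolyC0.
rewrite (deriv_ev2 _ _ (@mderivD _ _ _) (@mderivM _ _ _) _ X0') => [|c].
  by rewrite mderivXU (inj_eq lift_inj).
by rewrite mderivC.
Qed.

(** The matrix is lower triangular: [wrel l] involves only t and its own variable, and [vrel] is the
    last row. One factor comes from the diagonal entries of the [wrel l], the other from that of
    [vrel]. *)
Lemma det_etale_rel :
  \det (\matrix_(k < N.+1, l < N.+1) mderiv (lift ord0 l) (etale_rel k)) =
  \prod_l wrel' l * \prod_l wrel' l.
Proof.
rewrite det_trig; last first.
  apply/is_trig_mxP => k l kl; rewrite mxE /etale_rel.
  case: unliftP => [k'|] kE; last first.
    by move: kl; rewrite kE ltnNge -ltnS ltn_ord.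
  rewrite mderiv_wvar -kE [_ == _](negPf _) ?mulr0 //.
  by apply/eqP => E; rewrite E ltnn in kl.
rewrite big_ord_recr /=; congr (_ * _).
  apply: eq_bigr => l _; rewrite mxE /etale_rel.
  have -> : widen_ord (leqnSn N) l = lift ord_max l.
    by apply: val_inj; rewrite /= /bump leqNgt ltn_ord.
  by rewrite liftK mderiv_wvar eqxx mulr1.
rewrite mxE /etale_rel unlift_none /vrel mderivB mderivM mderivXU eqxx mul1r.
rewrite -mpolyC1 mderivC subr0 [X in _ + _ * X](_ : _ = 0) ?mulr0 ?addr0 //.
apply: (big_ind (fun p => mderiv (lift ord0 ord_max) p = 0)).
- exact: (mderivC _ 1).
- by move=> f g f0 g0; rewrite mderivM f0 g0 mul0r mulr0 addr0.
- move=> l _; rewrite /wrel' mderiv_wvar [_ == _](negPf _) ?mulr0 //.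
  by rewrite eq_sym neq_lift.
Qed.

Lemma etale_jacobian P : prime_of cst_y coord_y P -> jacobian_at cst_y coord_y
  P.
Proof.
move=> PP; exists etale_rel, (fun k => lift ord0 k).
split; first exact: etale_rel_vanishing.
rewrite /= det_etale_rel; have PiP : \prod_l wrel' l \notin P.
  have [[P0 P1 PI] _ sub] := PP; apply: contra P1 => PiP.
  have vP : vrel \in P by apply: sub; rewrite vanishing_seriesE mmap_vrel.
  have := PI (-1) _ _ vP (PI 'X_vvar _ 0 PiP P0).
  by rewrite addr0 /vrel mulN1r opprB subrK.
exact: prime_of_mulNin PP _ _.
Qed.

Lemma etale_separated (O1 O2 D : set (subfield_gen lcst (frac_point
  etale_point))) :
  is_scheme_point (chart := unit) cst_y (fun _ : unit => coord_y) O1 ->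
  is_scheme_point (chart := unit) cst_y (fun _ : unit => coord_y) O2 ->
  local_subring D -> dominates D O1 -> dominates D O2 -> O1 = O2.
Proof.
move=> [_ [P [PP ->]]] [_ [Q [QQ ->]]] _ DP DQ.
suff -> : P = Q by [].
apply/funext => f; apply/idP/idP; first exact: (dominated_prime_eq PP QQ DP DQ).
exact: (dominated_prime_eq QQ PP DQ DP).
Qed.

Lemma unit_nonempty : (0 < #|{: unit}|)%N.
Proof. by rewrite card_unit. Qed.

Definition etale_curve : curve K :=
  @Curve K (subfield_gen lcst (frac_point etale_point)) cst_y unit
    (fun=> N.+2) (fun=> coord_y) unit_nonempty
    (fun=> gen_field_gen_coord _ _)
    (fun=> affine_curve_series etale_point0 algebraic_etale_point)
    etale_separated.

Lemma etale_smooth : smooth_curve etale_curve.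
Proof.
move=> O [i [P [PP OE]]]; exists i, P; split=> //.
exact: etale_jacobian.
Qed.

Definition etale_specializes (c : 'I_N.+2 -> K) :=
  forall f, mmap (@psC K) etale_point f = 0 -> meval c f = 0.

Lemma specializes_etale c :
  specializes cst_y coord_y c <-> etale_specializes c.
Proof.
split=> cP f f0; apply: cP.
  by apply/eqP; rewrite evalF_series_eq0 f0.
by apply/eqP; rewrite -evalF_series_eq0 f0.
Qed.

Lemma etale_specializes_const : etale_specializes (fun j => ps_const
  (etale_point j)).
Proof.
move=> f f0; rewrite /meval -(rmorph0 (@ps_const K)) -f0 (rmorph_mmap (@ps_const
  K)).
by apply: eq_mmap => // c; apply/esym/ps_constC.
Qed.

(** The constant terms of the series give a rational point at t = 0, so ampleness applies; every
    rational point of the single chart comes from a specialization. *)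
Lemma infinite_etale_points : ample K ->
  infinite_set [set c | etale_specializes c].
Proof.
move=> /(_ _ etale_smooth) inf fin; apply: inf.
  have cP := (specializes_etale _).2 etale_specializes_const.
  by exists (curve_point (C := etale_curve) (i := tt) (fun j => ps_const
    (etale_point j)));
    apply: curve_point_rational.
apply: sub_finite_set (finite_image (fun c => curve_point (C := etale_curve) (i
  := tt) c) fin).
move=> O [[[] [P [PP OE]]] Oval].
have [|c cP PE] := rational_prime PP.
  by rewrite -OE => z /Oval [a [_ za]]; exists a.
exists c; first exact/specializes_etale.
by rewrite OE PE.
Qed.

End EtaleCurve.

(** * Specializations over ample fields *)

Section Specialization.
Variables (K : fieldType) (K_ample : ample K).
Local Notation R := (pseries K).
Local Notation t := (psX K).

Section Etale.
Variables (N : nat) (w : 'I_N -> R) (q : 'I_N -> {poly {poly K}}).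
Hypothesis qw : forall k, ev2 (@psC K) t (w k) (q k) = 0.
Hypothesis q'w : forall k, pcoef (ev2 (@psC K) t (w k) (q k)^`()) 0 != 0.
Local Notation eta := (etale_point w q).
Local Notation ev2K := (ev2 (idfun : {rmorphism K -> K})).

Lemma meval_ev2 (c : 'I_N.+2 -> K) (f g : {mpoly K[N.+2]}) p :
  meval c (ev2 (@mpolyC N.+2 K) f g p) = ev2K (meval c f) (meval c g) p.
Proof. by apply: rmorph_ev2 => a; rewrite /= mevalC. Qed.

Lemma meval_ev1 (c : 'I_N.+2 -> K) (f : {mpoly K[N.+2]}) p :
  meval c (ev1 (@mpolyC N.+2 K) f p) = ev1 (idfun : {rmorphism K -> K}) (meval c
    f) p.
Proof. by apply: rmorph_ev1 => a; rewrite /= mevalC. Qed.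

Definition jacK (c : 'I_N.+2 -> K) :=
  \prod_l ev2K (c ord0) (c (wvar l)) (q l)^`().

Lemma etale_specializes_jac c : etale_specializes w q c -> c (vvar N) * jacK c =
  1.
Proof.
move=> /(_ _ (mmap_vrel q'w)) /eqP;
  rewrite mevalB mevalM meval1 mevalXU subr_eq0.
rewrite rmorph_prod /= => /eqP <-; congr (_ * _); apply: eq_bigr => l _.
by rewrite meval_ev2 !mevalXU.
Qed.

(** Since h(eta) divides a nonzero b(t), the first coordinate of a zero of [h] is a root of b. Above
    it each w_l is a root of a polynomial, nonzero because its derivative does not vanish there, and
    the last coordinate is determined by the others. *)
Lemma finite_hypersurface h : mmap (@psC K) eta h != 0 ->
  finite_set [set c | etale_specializes w q c /\ meval c h = 0].
Proof.
move=> h0; have halg : algebraic_series (mmap (@psC K) eta h).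
  by apply: algebraic_series_mmap; exact: (algebraic_etale_point qw q'w).
have [b [g [b0 bE]]] := algebraic_series_divides_poly halg h0.
pose root_q a l := map_poly (ev1 (idfun : {rmorphism K -> K}) a) (q l).
pose B (j : 'I_N.+2) : set K :=
  if unlift ord0 j is Some k then
    (if unlift ord_max k is Some l then
       \bigcup_(a in [set a | root b a]) [set x | root_q a l != 0 /\ root
         (root_q a l) x]
     else [set 0])
  else [set a | root b a].
have Bfin j : finite_set (B j).
  rewrite /B; case: unliftP => [k|] _; last exact: finite_roots.
  case: unliftP => [l|] _; last exact: finite_set1.
  apply: bigcup_finite => [|a _]; first exact: finite_roots.
  have [r0|r0] := eqVneq (root_q a l) 0.
    by apply: (@sub_finite_set _ _ set0) => // x [].
  by apply: sub_finite_set (finite_roots r0) => x [].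
(* The last coordinate is replaced by the placeholder 0 in the finite box and recovered as the
   inverse of the Jacobian. *)
pose F (c : 'I_N.+2 -> K) j := if j == vvar N then (jacK c)^-1 else c j.
apply: sub_finite_set (finite_image F (finite_fun_set Bfin)) => c [cP hc].
have rb : root b (c ord0).
  have rel : mmap (@psC K) eta (ev1 (@mpolyC N.+2 K) 'X_ord0 b
      - h * ev2 (@mpolyC N.+2 K) 'X_ord0 h g) = 0.
    rewrite rmorphB rmorphM /= mmap_ev1 mmap_ev2 !mmapXU etale_point0.
    by rewrite bE subrr.
  have := cP _ rel; rewrite mevalB mevalM hc mul0r subr0 meval_ev1 mevalXU.
  by rewrite /ev1 /= /horner_eval map_poly_id // => /eqP.
have cjac := etale_specializes_jac cP.
have jac0 : jacK c != 0.
  by apply/eqP => j0; move/eqP: cjac; rewrite j0 mulr0 eq_sym oner_eq0.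
have wvarN l : (wvar l == vvar N) = false.
  by rewrite /wvar /vvar (inj_eq lift_inj) eq_sym (negPf (neq_lift _ _)).
pose c' j := if j == vvar N then 0 else c j.
have c'0 : c' ord0 = c ord0 by [].
have c'w l : c' (wvar l) = c (wvar l) by rewrite /c' wvarN.
exists c'; last first.
  apply/funext => j; rewrite /F /c'; case: eqP => // ->.
  have -> : jacK c' = jacK c.
    by apply: eq_bigr => l _; rewrite c'0 c'w.
  by apply: (mulIf jac0); rewrite cjac mulVf.
move=> j; rewrite /B; case: unliftP => [k ->|-> //].
case: unliftP => [l ->|->]; last by rewrite /c' eqxx.
exists (c ord0) => //=; rewrite -/(wvar l) c'w; split.
  have /prodf_neq0 /(_ l isT) := jac0; apply: contraNneq => r0.
  by rewrite /ev2 /= -deriv_map -/(root_q (c ord0) l) r0 deriv0 /horner_eval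
    horner0.
have qrel : mmap (@psC K) eta (ev2 (@mpolyC N.+2 K) 'X_ord0 'X_(wvar l) (q l)) =
  0.
  by rewrite mmap_ev2_wvar qw.
by have /eqP := cP _ qrel; rewrite meval_ev2 !mevalXU.
Qed.

Lemma etale_specialization h : mmap (@psC K) eta h != 0 ->
  exists2 c, etale_specializes w q c & meval c h != 0.
Proof.
move=> /finite_hypersurface fin.
have := infinite_etale_points qw q'w K_ample.
move=> inf; apply: contrapT => noc; apply: inf;
  apply: sub_finite_set fin => c cP.
split=> //; apply/eqP/negPn/negP => hc; apply: noc; by exists c.
Qed.

End Etale.

(** By [simple_tail] each y_k is P_k(t) + t^(N_k) w_k. The substitution [lq] pulls polynomials in
    [y] back to the etale curve of the w_k, where points outside a hypersurface exist. *)
Lemma ample_specialization n (y : 'I_n -> R) (h : {mpoly K[n]}) :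
  (forall k, algebraic_series (y k)) -> mmap (@psC K) y h != 0 ->
  exists2 c, (forall f, mmap (@psC K) y f = 0 -> meval c f = 0) & meval c h !=
    0.
Proof.
move=> yalg hy.
have /choice [d dP] : forall k, exists d : nat * {poly K} * R * {poly {poly K}},
    [/\ y k = ps_of_poly d.1.1.2 + t ^+ d.1.1.1 * d.1.2,
        ev2 (@psC K) t d.1.2 d.2 = 0 &
        pcoef (ev2 (@psC K) t d.1.2 d.2^`()) 0 != 0].
  by move=> k; have [e [P [w [q H]]]] := simple_tail (yalg k);
    exists (e, P, w, q).
pose w k := (d k).1.2; pose q k := (d k).2.
have qw k : ev2 (@psC K) t (w k) (q k) = 0 by have [] := dP k.
have q'w k : pcoef (ev2 (@psC K) t (w k) (q k)^`()) 0 != 0 by have [] := dP k.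
pose lq := [tuple ev1 (@mpolyC n.+2 K) 'X_ord0 (d k).1.1.2 +
                  'X_ord0 ^+ (d k).1.1.1 * 'X_(wvar k) | k < n].
have yE f : mmap (@psC K) (etale_point w q) (f \mPo lq) = mmap (@psC K) y f.
  rewrite mmap_comp_mpoly; apply: eq_mmap => // k; rewrite tnth_mktuple.
  have [-> _ _] := dP k; rewrite rmorphD rmorphM rmorphXn /= !mmapXU.
  by rewrite mmap_ev1 mmapXU etale_point0 etale_point_w ev1_psX.
have [|c cP hc] := etale_specialization qw q'w (h := h \mPo lq);
  first by rewrite yE.
exists (fun k => meval c (tnth lq k)); last by rewrite -comp_mpoly_meval.
by move=> f f0; rewrite -comp_mpoly_meval; apply: cP; rewrite yE.
Qed.

(** If K were finite, the product of all X - a would be nonzero at the series t but zero at every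
    specialization. *)
Lemma ample_infinite : infinite_set [set: K].
Proof.
move=> /finite_seqP [s sE].
have tX : mmap (@psC K) (fun _ : 'I_1 => t) (\prod_(a <- s) ('X_ord0 - a%:MP))
  != 0.
  rewrite rmorph_prod /= prodf_seq_neq0; apply/allP => a _ /=.
  rewrite rmorphB /= mmapXU mmap_polyC;
    apply/eqP => /(congr1 (fun f => pcoef f 1)).
  rewrite pcoefB pcoefC pcoef_0 subr0 /= coefX => /eqP; by rewrite oner_eq0.
have [k|c _] := ample_specialization _ tX; first exact: algdep_refl.
rewrite rmorph_prod /= prodf_seq_neq0 => /allP /(_ (c ord0)).
have -> : c ord0 \in s by have : [set: K] (c ord0) by []; rewrite sE.
by move=> /(_ isT) /=; rewrite mevalB mevalXU mevalC subrr eqxx.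
Qed.

End Specialization.

(** * Local expansions *)

Section Residue.
Variables (K F : fieldType) (iota : {rmorphism K -> F}) (m : nat).
Variables (xi : 'I_m -> F) (c : 'I_m -> K).
Hypothesis cP : specializes iota xi c.
Local Notation residue := (residue iota xi c).
Local Notation ev := (evalF iota xi).

Lemma evalF_neq0 g : meval c g != 0 -> ev g != 0.
Proof. by apply: contra_neq => /cP. Qed.

Lemma evalFD f g : ev (f + g) = ev f + ev g.
Proof. by rewrite /evalF rmorphD. Qed.
Lemma evalFB f g : ev (f - g) = ev f - ev g.
Proof. by rewrite /evalF rmorphB. Qed.
Lemma evalFM f g : ev (f * g) = ev f * ev g.
Proof. by rewrite /evalF rmorphM. Qed.
Lemma evalFC a : ev a%:MP = iota a.
Proof. by rewrite /evalF mmap_polyC. Qed.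
Lemma evalFXU j : ev 'X_j = xi j.
Proof. by rewrite /evalF mmapXU. Qed.

Lemma residue_evalF f : residue (ev f) (meval c f).
Proof.
exists f, 1; rewrite meval1 oner_eq0 -[1]/(1%:MP) evalFC rmorph1 !divr1 //.
Qed.

Lemma residueC a : residue (iota a) a.
Proof. by have := residue_evalF a%:MP; rewrite evalFC mevalC. Qed.

Lemma residueD x y a b : residue x a -> residue y b -> residue (x + y) (a + b).
Proof.
move=> [f [g [g0 -> ->]]] [f' [g' [g'0 -> ->]]].
exists (f * g' + f' * g), (g * g').
by rewrite mevalD !mevalM evalFD !evalFM mulf_neq0 // !addf_div // evalF_neq0.
Qed.

Lemma residueM x y a b : residue x a -> residue y b -> residue (x * y) (a * b).
Proof.
move=> [f [g [g0 -> ->]]] [f' [g' [g'0 -> ->]]].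
exists (f * f'), (g * g').
by rewrite !mevalM !evalFM mulf_neq0 // !mulf_div.
Qed.

Lemma residueN x a : residue x a -> residue (- x) (- a).
Proof.
by move=> /(residueM (residueC (-1))); rewrite rmorphN rmorph1 !mulN1r.
Qed.

Lemma residueV x a : residue x a -> a != 0 -> residue x^-1 a^-1.
Proof.
move=> [f [g [g0 -> ->]]]; rewrite mulf_eq0 negb_or => /andP [f0 _].
by exists g, f; rewrite !invf_div.
Qed.

Lemma residue_inj x a b : residue x a -> residue x b -> a = b.
Proof.
move=> [f [g [g0 -> ->]]] [f' [g' [g'0 E ->]]].
have : ev (f * g' - f' * g) = 0.
  apply/eqP; rewrite evalFB !evalFM subr_eq0 -eqr_div ?evalF_neq0 //.
  exact/eqP.
move=> /cP /eqP; rewrite mevalB !mevalM subr_eq0 => H.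
by apply/eqP; rewrite eqr_div.
Qed.

Lemma residue_mmap n (x : 'I_n -> F) (a : 'I_n -> K) f :
  (forall k, residue (x k) (a k)) -> residue (mmap iota x f) (meval a f).
Proof.
move=> xa; elim/mpoly_ring_ind: f => [b|k|f g fa ga|f g fa ga].
- by rewrite mmap_polyC mevalC; apply: residueC.
- by rewrite mmapXU mevalXU.
- by rewrite rmorphD mevalD; apply: residueD.
- by rewrite rmorphM mevalM; apply: residueM.
Qed.

Definition regular z := exists a, residue z a.

Lemma regularD x y : regular x -> regular y -> regular (x + y).
Proof. by move=> [a xa] [b yb]; exists (a + b); apply: residueD. Qed.
Lemma regularM x y : regular x -> regular y -> regular (x * y).
Proof. by move=> [a xa] [b yb]; exists (a * b); apply: residueM. Qed.
Lemma regularC a : regular (iota a).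
Proof. by exists a; apply: residueC. Qed.
Lemma regular_evalF f : regular (ev f).
Proof. by exists (meval c f); apply: residue_evalF. Qed.

Section Uniformizer.
Variable tau : F.
Hypothesis tau0 : tau != 0.
Hypothesis tau_res : residue tau 0.
Hypothesis xi_tau : forall j, exists2 u, regular u & xi j - iota (c j) = tau *
  u.

(** The numerator of z - a vanishes at [c], hence is a combination of the xi_j - c_j, which are all
    multiples of [tau]. *)
Lemma regular_shift z : regular z ->
  exists a r, [/\ residue z a, regular r & z = iota a + tau * r].
Proof.
move=> [a za]; have [f [g [g0 zE aE]]] := za; exists a.
pose h := f - a%:MP * g.
have hc : meval c h = 0 by rewrite mevalB mevalM mevalC aE divfK // subrr.
have gF := evalF_neq0 g0.
have [G [hE _]] := mpoly_hadamard c h.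
have [r rreg hr] : exists2 r, regular r & ev h = tau * r.
  rewrite hc mpolyC0 subr0 in hE; rewrite hE.
  apply: (big_ind (fun p => exists2 r, regular r & ev p = tau * r)) => [|p p'|j
    _].
  - exists 0; last by rewrite /evalF rmorph0 mulr0.
    by rewrite -(rmorph0 iota); apply: regularC.
  - move=> [r rr pE] [s ss p'E]; exists (r + s); first exact: regularD.
    by rewrite evalFD pE p'E mulrDr.
  - have [u ur uE] := xi_tau j; exists (ev (G j) * u).
      by apply: regularM => //; apply: regular_evalF.
    by rewrite mulrCA -uE evalFM evalFB evalFXU evalFC.
exists (r / ev g); split=> //.
  have [b rb] := rreg; exists (b / meval c g); apply: residueM => //.
  by apply: residueV => //; apply: residue_evalF.
rewrite mulrA -hr /h evalFB evalFM evalFC mulrBl mulfK // addrC subrK.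
exact: zE.
Qed.

(** Approximation to every order with a regular remainder takes the place of the completed local
    ring. *)
Definition expands z (s : pseries K) := forall n,
  exists2 r, regular r & z = ev1 iota tau (ps_trunc n s) + tau ^+ n * r.

Lemma ps_truncS n (s : pseries K) :
  ps_trunc n.+1 s = ps_trunc n s + pcoef s n *: 'X^n.
Proof. by rewrite /ps_trunc !poly_def big_ord_recr. Qed.

Lemma ev1_monomial a n : ev1 iota tau (a *: 'X^n) = iota a * tau ^+ n.
Proof. by rewrite -mul_polyC rmorphM rmorphXn /= ev1C ev1X. Qed.

Lemma expands_exists z : regular z -> exists s, expands z s.
Proof.
move=> zreg.
(* [d] picks the constant term and the quotient by [tau]; iterating it yields the coefficients. At
   non-regular elements it has the dummy value (0, 0). *)
have /choice [d dP] : forall x, exists d : K * F, regular x ->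
    [/\ residue x d.1, regular d.2 & x = iota d.1 + tau * d.2].
  move=> x; have [/regular_shift [a [r H]]|] := pselect (regular x); last first.
    by exists (0, 0).
  by exists (a, r).
pose x n := iter n (fun x => (d x).2) z.
have xreg n : regular (x n).
  by elim: n => // n IHn; have [] := dP _ IHn.
exists (PSeries (fun n => (d (x n)).1)) => n; exists (x n) => //.
elim: n => [|n IHn]; first by rewrite /ps_trunc poly_def big_ord0 rmorph0 add0r
  mul1r.
rewrite ps_truncS rmorphD /= ev1_monomial {1}IHn -addrA; congr (_ + _).
have [_ _ {1}->] := dP _ (xreg n).
by rewrite exprSr mulrDr mulrA [iota _ * _]mulrC.
Qed.

Lemma expandsD z z' s s' : expands z s -> expands z' s' -> expands (z + z') (s +
  s').
Proof.
move=> zs zs' n; have [r rr ->] := zs n; have [r' rr' ->] := zs' n.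
exists (r + r'); first exact: regularD.
have -> : ps_trunc n (s + s') = ps_trunc n s + ps_trunc n s'.
  by apply/polyP => i; rewrite coefD !coef_poly; case: ifP; rewrite ?addr0.
by rewrite rmorphD mulrDr addrACA.
Qed.

Lemma regular_tauX n : regular (tau ^+ n).
Proof.
elim: n => [|n IHn]; first by rewrite expr0 -(rmorph1 iota); apply: regularC.
by rewrite exprS; apply: regularM => //; exists 0.
Qed.

Lemma regular_ev1 p : regular (ev1 iota tau p).
Proof.
rewrite -(coefK p) poly_def rmorph_sum; apply: big_ind.
- by rewrite -(rmorph0 iota); apply: regularC.
- exact: regularD.
move=> i _; rewrite /= ev1_monomial.
by apply: regularM; [apply: regularC | apply: regular_tauX].
Qed.

Lemma expandsM z z' s s' : expands z s -> expands z' s' -> expands (z * z') (s *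
  s').
Proof.
move=> zs zs' n; have [r rr ->] := zs n; have [r' rr' ->] := zs' n.
pose P := ps_trunc n s; pose P' := ps_trunc n s'.
exists (ev1 iota tau (drop_poly n (P * P')) + (ev1 iota tau P * r' + r * ev1
  iota tau P')
        + tau ^+ n * (r * r')).
  have reg1 := regular_ev1; have reg2 := regular_tauX.
  by do !(apply: regularD || apply: regularM).
have PP' : P * P' = ps_trunc n (s * s') + drop_poly n (P * P') * 'X^n.
  rewrite -[LHS](poly_take_drop n); congr (_ + _); apply/polyP => i.
  rewrite coef_take_poly coef_poly; case: ltnP => // ltin.
  rewrite pcoefM_trunc; apply: coefM_eq => k ki.
    by rewrite !coef_ps_trunc // (leq_ltn_trans ki).
  by rewrite !coef_ps_trunc // (leq_ltn_trans ki).
have := congr1 (ev1 iota tau) PP'.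
rewrite rmorphM rmorphD rmorphM rmorphXn /= ev1X -/P -/P' => E.
transitivity (ev1 iota tau P * ev1 iota tau P' + tau ^+ n * (ev1 iota tau P * r'
   + r * ev1 iota tau P') + tau ^+ n * (tau ^+ n * (r * r'))); first by ring.
by rewrite E; ring.
Qed.

Lemma expandsC a : expands (iota a) (psC a).
Proof.
case=> [|n].
  exists (iota a); first exact: regularC.
  by rewrite /ps_trunc poly_def big_ord0 rmorph0 add0r mul1r.
exists 0; first by rewrite -(rmorph0 iota); apply: regularC.
have -> : ps_trunc n.+1 (psC a) = a%:P.
  apply/polyP => i; rewrite coef_poly pcoefC coefC.
  by case: ltnP => //; case: i.
by rewrite ev1C mulr0 addr0.
Qed.

Lemma expands_tau : expands tau (psX K).
Proof.
have reg0 : regular 0 by rewrite -(rmorph0 iota); apply: regularC.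
case=> [|[|n]].
- exists tau; first by exists 0.
  by rewrite /ps_trunc poly_def big_ord0 rmorph0 add0r mul1r.
- exists 1; first by rewrite -(rmorph1 iota); apply: regularC.
  by rewrite /ps_trunc poly_def big_ord1 /= coefX scale0r rmorph0 add0r mulr1.
exists 0 => //; have -> : ps_trunc n.+2 (psX K) = 'X.
  by apply/polyP => i; rewrite coef_poly /= coefX; case: i => [|[|i]] //=;
    case: ifP.
by rewrite ev1X mulr0 addr0.
Qed.

(** If the lowest term of [s] had degree v, dividing the expansion of 0 to order v + 1 by [tau ^+ v]
    would give its coefficient residue 0. *)
Lemma expands_uniq0 s : expands 0 s -> s = 0.
Proof.
move=> s_0; apply/eqP/negPn/negP => /ps_order [v [u [sE u0]]].
have [r [b rb] E] := s_0 v.+1.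
have trE : ps_trunc v.+1 s = pcoef u 0 *: 'X^v.
  apply/polyP => i; rewrite coef_poly coefZ coefXn sE pcoefXnM.
  case: (ltngtP i v) => [iv|vi|->].
  - by rewrite ltnS ltnW // mulr0.
  - by rewrite ltnS leqNgt vi mulr0.
  - by rewrite ltnSn subnn mulr1.
move/esym/eqP: E; rewrite trE ev1_monomial exprSr [iota _ * _]mulrC -mulrA
  -mulrDr.
rewrite mulf_eq0 expf_eq0 (negPf tau0) andbF /= => /eqP E.
have := residueD (residueC (pcoef u 0)) (residueM tau_res rb).
rewrite E mul0r addr0 -(rmorph0 iota) => /residue_inj /(_ (residueC 0)) u00.
by rewrite u00 eqxx in u0.
Qed.

Lemma expands_uniq z s s' : expands z s -> expands z s' -> s = s'.
Proof.
move=> zs zs'; apply/eqP; rewrite -subr_eq0; apply/eqP/expands_uniq0.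
have := expandsD zs (expandsM (expandsC (-1)) zs').
by rewrite !rmorphN !rmorph1 !mulN1r subrr.
Qed.

Lemma expands_mmap n (x : 'I_n -> F) (s : 'I_n -> pseries K) f :
  (forall k, expands (x k) (s k)) ->
  expands (mmap iota x f) (mmap (@psC K) s f).
Proof.
move=> xs; elim/mpoly_ring_ind: f => [b|k|f g fa ga|f g fa ga].
- by rewrite !mmap_polyC; apply: expandsC.
- by rewrite !mmapXU.
- by rewrite !rmorphD; apply: expandsD.
- by rewrite !rmorphM; apply: expandsM.
Qed.

(** Expansion is injective on K[xi]: a nonzero element divides some b(tau) with b nonzero, whose
    expansion is b itself. Hence it extends to the fraction field F. *)
Lemma local_expansion :
  gen_field iota xi = setT -> (forall z, algdep iota tau z) ->
  exists (y : 'I_m -> pseries K)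
    (s : {rmorphism F -> {fraction pseries K}}),
  [/\ forall f, s (ev f) = (mmap (@psC K) y f)%:F, s tau = (psX K)%:F &
      forall j, expands (xi j) (y j)].
Proof.
move=> gen alg.
have /choice [y yP] : forall j, exists s, expands (xi j) s.
  by move=> j; apply: expands_exists; rewrite -evalFXU; apply: regular_evalF.
have evP f : expands (ev f) (mmap (@psC K) y f) by apply: expands_mmap.
have frac z : exists f g, ev g != 0 /\ z = ev f / ev g.
  by have : [set: F] z by []; rewrite -gen.
have [|s sE] := @extend_to_fractions {mpoly K[m]} F {fraction pseries K}
    (mmap iota xi) (@FracField.tofrac _ \o mmap (@psC K) y) frac.
  move=> f /=; rewrite tofrac_eq0 -/(ev f); apply/idP/idP => [|/eqP f0];
    last first.
    by apply/eqP/expands_uniq0; rewrite -f0.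
  apply: contraTT => f0;
    have [b [g [b0 bE]]] := algdep_divides_poly (alg (ev f)) f0.
  have lhs : expands (ev1 iota tau b) (ps_of_poly b).
    rewrite -ev1_psX -!(ev2C _ _ 0) -!mmap_of_pp; apply: expands_mmap => k.
    rewrite /point2; case: ifP => _; first exact: expands_tau.
    by rewrite -(rmorph0 iota) -(rmorph0 (@psC K)); apply: expandsC.
  have rhs : expands (ev2 iota tau (ev f) g)
      (ev2 (@psC K) (psX K) (mmap (@psC K) y f) g).
    rewrite -!mmap_of_pp; apply: expands_mmap => k.
    by rewrite /point2; case: ifP => _; [exact: expands_tau | exact: evP].
  rewrite bE in lhs; have := expands_uniq lhs (expandsM (evP f) rhs).
  move=> E; apply: contraNneq b0 => y0; rewrite y0 mul0r in E.
  by apply/eqP/(@ps_of_poly_inj K); rewrite E rmorph0.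
exists y, s; split=> //.
(* [s] is known on the elements [ev f] only, so its value at [tau] is read off from tau g = f by
   uniqueness of expansions. *)
have [f [g [g0 tE]]] := frac tau.
have tg : tau * ev g = ev f by rewrite tE divfK.
have /(expands_uniq (evP f)) : expands (ev f) (psX K * mmap (@psC K) y g).
  by rewrite -tg; apply: expandsM => //; apply: expands_tau.
move=> E; have sg : s (ev g) != 0 by rewrite fmorph_eq0.
by apply: (mulIf sg); rewrite -rmorphM tg !sE /= E rmorphM.
Qed.

End Uniformizer.

(** Otherwise all coordinates, and with them all elements of F, would be constants. *)
Lemma uniformizer_neq0 tau :
  (exists z, transc iota z) -> gen_field iota xi = setT ->
  (forall j, exists2 u, regular u & xi j - iota (c j) = tau * u) -> tau != 0.
Proof.
move=> [z zT] gen xi_tau; apply/eqP => tau0.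
have xiE j : xi j = iota (c j).
  by have [u _ /eqP] := xi_tau j; rewrite tau0 mul0r subr_eq0 => /eqP.
have evE f : ev f = iota (meval c f).
  by rewrite /meval rmorph_mmap; apply: eq_mmap.
have [f [g [g0 zE]]] : gen_field iota xi z by rewrite gen.
have := zT ('X - (meval c f / meval c g)%:P).
rewrite rmorphB /= ev1X ev1C zE !evE fmorph_div subrr => /(_ erefl) /eqP.
by rewrite polyXsubC_eq0.
Qed.

End Residue.

(** * Uniformizers and separability *)

Section FunctionFieldOfCurve.
Variables (K F : fieldType) (iota : {rmorphism K -> F}) (m : nat).
Variables (xi : 'I_m -> F).
Hypothesis gen : gen_field iota xi = setT.
Hypothesis dim1 : has_dim (vanishing iota xi) 1.
Local Notation ev := (evalF iota xi).

Lemma transc_evalF : exists f, transc iota (ev f).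
Proof.
have [[f fI] _] := dim1; exists (tnth f ord0) => p p0.
have : (ev1 (@mpolyC 1 K) 'X_ord0 p) = 0.
  apply: fI; rewrite inE /evalF mmap_comp_mpoly mmap_ev1 mmapXU.
  by rewrite p0.
move=> /(congr1 (mmap polyC (fun=> 'X))); rewrite mmap_ev1 mmapXU rmorph0.
by rewrite /ev1 /= /horner_eval -/(comp_poly 'X p) comp_polyXr.
Qed.

Lemma exists_transc : exists z, transc iota z.
Proof. by have [f fT] := transc_evalF; exists (ev f). Qed.

Lemma algdep_evalF f g : algdep iota (ev f) (ev g).
Proof.
have [_ /(_ [tuple f; g]) /existsNP [p /not_implyP [pI /eqP p0]]] := dim1.
exists p; split=> //; move: pI; rewrite inE /evalF mmap_comp_mpoly => /eqP <-.
apply: eq_mmap => // k; rewrite (point2P (fun k => mmap iota xi (tnth _ k))).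
by rewrite /= !(tnth_nth 0).
Qed.

Lemma algdep_all z z' : algdep iota z z'.
Proof.
have [f xT] := transc_evalF; pose x := ev f.
have alg y : algdep iota x y.
  have [a [b [b0 ->]]] : gen_field iota xi y by rewrite gen.
  apply: algdep_mul => //; first exact: algdep_evalF.
  by apply: algdep_inv => //; apply: algdep_evalF.
exact: algdep_exchange xT (alg z) (alg z').
Qed.

Section Jacobian.
Variables (c : 'I_m -> K) (f : 'I_m.-1 -> {mpoly K[m]}) (g : 'I_m.-1 -> 'I_m).
Hypothesis cP : specializes iota xi c.
Hypothesis fI : forall k, f k \in vanishing iota xi.
Hypothesis detJ :
  \det (\matrix_(k < m.-1, l < m.-1) mderiv (g l) (f k)) \notin point_ideal c.

(** [l0] is the one index missed by the injective [g]. Multiplying the Taylor expansions of the f_k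
    by the adjugate of [A] expresses det A (xi_j - c_j) through xi_l0 - c_l0, and det A has nonzero
    residue. *)
Lemma jacobian_uniformizer : exists l0, forall j,
  exists2 u, regular iota xi c u & xi j - iota (c j) = (xi l0 - iota (c l0)) *
    u.
Proof.
(* For m = 0 the last hypothesis of [uniformizer_neq0] would hold vacuously with tau = 0. *)
have m_gt0 : (0 < m)%N.
  rewrite lt0n; apply/eqP => m0; have := eqxx (0 : F); apply/negP.
  apply: (uniformizer_neq0 (c := c) exists_transc gen) => j.
  by exfalso; case: j => j; rewrite m0.
have g_inj : injective g.
  move=> l l' gl; apply/eqP/negPn/negP => ll'; move: detJ.
  rewrite -det_tr (determinant_alternate ll') ?unfold_in ?meval0 ?eqxx //.
  by move=> k; rewrite !mxE gl.
have [l0 l0P] : exists l0, ~: [set g l | l : 'I_m.-1] = [set l0]%SET.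
  apply/cards1P; rewrite cardsCs finset.setCK card_imset // !card_ord.
  by rewrite -[X in (X - _)%N](prednK m_gt0) subSnn.
have sumE (H : 'I_m -> {mpoly K[m]}) : \sum_j H j = H l0 + \sum_l H (g l).
  rewrite (bigD1 l0) //=; congr (_ + _).
  rewrite -(big_imset H (h := g) (A := predT)) /=; last by move=> x y _ _;
    apply: g_inj.
  apply: eq_bigl => j; have /finset.setP /(_ j) := l0P.
  by rewrite !inE => /esym ->; rewrite negbK.
exists l0 => j.
have [->|jl0] := eqVneq j l0.
  by exists 1; rewrite ?mulr1 // -(rmorph1 iota); apply: regularC.
have [l ->] : exists l, j = g l.
  have /finset.setP /(_ j) := l0P;
    rewrite !inE (negPf jl0) => /negbFE /imsetP [l _ ->].
  by exists l.
have /choice [G GP] : forall k, exists G : 'I_m -> {mpoly K[m]},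
    f k = \sum_j G j * ('X_j - (c j)%:MP) /\
    forall j, meval c (G j) = meval c (mderiv j (f k)).
  move=> k; have [G [fE Gc]] := mpoly_hadamard c (f k); exists G; split=> //.
  have /cP fc : ev (f k) = 0 by have := fI k; rewrite inE => /eqP.
  by rewrite -fE fc mpolyC0 subr0.
pose A := \matrix_(k < m.-1, l < m.-1) G k (g l).
have detA : meval c (\det A) != 0.
  have -> : meval c (\det A) =
    meval c (\det (\matrix_(k < m.-1, l < m.-1) mderiv (g l) (f k))).
    rewrite -!det_map_mx; congr (\det _); apply/matrixP => a b.
    by rewrite !mxE /=; have [_ ->] := GP a.
  by move: detJ; rewrite unfold_in.
pose B := \sum_k (\adj A) l k * G k l0.
have rel : \sum_k (\adj A) l k * f k =
    B * ('X_l0 - (c l0)%:MP) + \det A * ('X_(g l) - (c (g l))%:MP).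
  have -> : \sum_k (\adj A) l k * f k =
    \sum_j (\sum_k (\adj A) l k * G k j) * ('X_j - (c j)%:MP).
    under eq_bigr => k _ do rewrite (GP k).1 mulr_sumr.
    rewrite exchange_big /=; apply: eq_bigr => i _; rewrite mulr_suml.
    by apply: eq_bigr => k _; rewrite mulrA.
  have colE l' : \sum_k (\adj A) l k * G k (g l') = \det A *+ (l == l').
    have /matrixP /(_ l l') := mul_adj_mx A; rewrite !mxE => <-.
    by apply: eq_bigr => k _; rewrite !mxE.
  rewrite sumE; congr (_ + _); under eq_bigr => l' _ do rewrite colE.
  rewrite (bigD1 l) //= eqxx mulr1n big1 ?addr0 // => l';
    rewrite eq_sym => /negPf ->.
  by rewrite mulr0n mul0r.
have dF := evalF_neq0 cP detA.
exists (- (ev B / ev (\det A))).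
  exists (- (meval c B / meval c (\det A))); apply: residueN; apply: residueM.
    exact: residue_evalF.
  by apply: residueV => //; apply: residue_evalF.
have := congr1 ev rel.
have -> : ev (\sum_k (\adj A) l k * f k) = 0.
  rewrite /evalF rmorph_sum big1 //= => k _; rewrite rmorphM /=.
  by have := fI k; rewrite inE => /eqP; rewrite /evalF => ->; rewrite mulr0.
rewrite evalFD !evalFM !evalFB !evalFXU !evalFC => /esym/eqP.
rewrite addrC addr_eq0 => /eqP E; apply: (mulfI dF).
by rewrite E mulrN mulrN; congr (- _); field.
Qed.

End Jacobian.

Section Etale.
Variables (c : 'I_m -> K) (phi : F) (e : K) (p : 'I_m -> {mpoly K[2]}).
Hypothesis cP : specializes iota xi c.
Hypothesis phi_e : residue iota xi c phi e.
Hypothesis p0 : forall j, mmap iota (point2 phi (xi j)) (p j) = 0.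
Hypothesis p'0 : forall j, exists2 b, b != 0 &
  residue iota xi c (mmap iota (point2 phi (xi j)) (mderiv ord_max (p j))) b.

(** The Taylor expansion of p_j at (e, c_j) reads G0 (phi - e) + G1 (xi_j - c_j) = 0, where G1 has
    as residue the nonzero value of the partial derivative. *)
Lemma etale_uniformizer j :
  exists2 u, regular iota xi c u & xi j - iota (c j) = (phi - iota e) * u.
Proof.
have xr (k : 'I_2) : residue iota xi c (point2 phi (xi j) k) (point2 e (c j) k).
  rewrite /point2; case: ifP => // _.
  by have := residue_evalF iota xi c 'X_j; rewrite evalFXU mevalXU.
have [G [pE Gc]] := mpoly_hadamard (point2 e (c j)) (p j).
have pc : meval (point2 e (c j)) (p j) = 0.
  apply: (residue_inj cP (residue_mmap cP _ xr)).
  by rewrite p0 -(rmorph0 iota); apply: residueC.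
have [b b0 p'b] := p'0 j.
have bE : b = meval (point2 e (c j)) (G ord_max).
  by rewrite Gc; apply: (residue_inj cP p'b); apply: residue_mmap.
pose G0 := mmap iota (point2 phi (xi j)) (G ord0).
pose G1 := mmap iota (point2 phi (xi j)) (G ord_max).
have G1r : residue iota xi c G1 b by rewrite bE; apply: residue_mmap.
have G1_0 : G1 != 0.
  apply: contraNneq b0 => G10; apply/eqP; apply: (residue_inj cP G1r).
  by rewrite G10 -(rmorph0 iota); apply: residueC.
exists (- (G0 / G1)).
  exists (- (meval (point2 e (c j)) (G ord0) / b)); apply: residueN;
    apply: residueM.
    exact: residue_mmap.
  exact: residueV.
have := congr1 (mmap iota (point2 phi (xi j))) pE.
rewrite pc mpolyC0 subr0 p0 big_ord_recl big_ord1 rmorphD !rmorphM !rmorphB /=.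
have -> : lift ord0 ord0 = ord_max :> 'I_2 by apply: val_inj.
rewrite !mmapXU !mmap_polyC /= -/G0 -/G1 => /esym/eqP.
rewrite addrC addr_eq0 => /eqP E; apply: (mulfI G1_0).
by rewrite [LHS]E !mulrN mulrCA [G1 * _]mulrC divfK // mulrC.
Qed.

End Etale.
End FunctionFieldOfCurve.

(** * The derivation of K((t)) and separable equations *)

Section Separability.
Variables (K : fieldType).
Local Notation L := {fraction pseries K}.
Local Notation lcst := (@lcst K).

Lemma fr_deriv_horner (P : {poly L}) x :
  (forall k, fr_deriv P`_k = 0) -> fr_deriv P.[x] = P^`().[x] * fr_deriv x.
Proof.
elim/poly_ind: P => [|P b IHP] Pk.
  by rewrite deriv0 !horner0 mul0r -(rmorph0 lcst) fr_derivC.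
have bE := Pk 0%N; rewrite coefD coefMX coefC add0r /= in bE.
have PkS k : fr_deriv P`_k = 0.
  by have := Pk k.+1; rewrite coefD coefMX coefC addr0.
rewrite hornerMXaddC fr_derivD fr_derivM bE addr0 IHP //.
by rewrite derivD derivM derivX derivC mulr1 addr0 hornerD hornerM hornerX;
  ring.
Qed.

Lemma fr_deriv_gen_field n (F : fieldType) (iota : {rmorphism K -> F})
    (s : {rmorphism F -> L}) (phi : 'I_n -> F) z :
  s \o iota =1 lcst -> (forall k, fr_deriv (s (phi k)) = 0) ->
  gen_field iota phi z -> fr_deriv (s z) = 0.
Proof.
move=> siota phi0 [f [g [g0 zE]]].
have ev0 h : fr_deriv (s (evalF iota phi h)) = 0.
  rewrite /evalF rmorph_mmap (eq_mmap (j := lcst) (y := s \o phi)) //.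
  rewrite (deriv_mmap _ _ (@fr_derivD K) (@fr_derivM K) (@fr_derivC K)) big1 //
    => k _.
  by rewrite phi0 mulr0.
have := ev0 f; have -> : evalF iota phi f = z * evalF iota phi g by rewrite zE
  divfK.
rewrite rmorphM fr_derivM ev0 mulr0 addr0 => /eqP.
by rewrite mulf_eq0 fmorph_eq0 (negPf g0) orbF => /eqP.
Qed.

Lemma separable_root_deriv (F : fieldType) (p : {poly F}) z :
  separable_poly p -> root p z -> p^`().[z] != 0.
Proof.
move=> psep /factor_theorem [u pE].
have : coprimep u ('X - z%:P) by apply: (separable_coprime psep); rewrite pE.
have zz : root ('X - z%:P) z by rewrite root_XsubC.
rewrite coprimep_sym => /coprimep_root /(_ zz).
by rewrite pE derivM derivXsubC mulr1 hornerD hornerM hornerXsubC subrr mulr0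
  add0r.
Qed.

End Separability.

(** * Points at which the map is etale *)

Section GoodPoints.
Variables (K F : fieldType) (iota : {rmorphism K -> F}) (m : nat).
Variables (xi : 'I_m -> F).
Hypothesis K_ample : ample K.
Hypothesis gen : gen_field iota xi = setT.
Hypothesis dim1 : has_dim (vanishing iota xi) 1.
Local Notation ev := (evalF iota xi).
Local Notation R := (pseries K).
Local Notation L := {fraction pseries K}.
Local Notation lcst := (@lcst K).
Local Notation t := (psX K).
Local Notation specializes := (specializes iota xi).
Local Notation residue := (residue iota xi).
Local Notation regular := (regular iota xi).

(** [H] is the product of the numerators and denominators of all elements of [s]. *)
Lemma nonzero_residues (s : seq F) : (forall z, z \in s -> z != 0) ->
  exists2 H, ev H != 0 & forall c, specializes c -> meval c H != 0 ->
    forall z, z \in s -> exists2 b, b != 0 & residue c z b.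
Proof.
elim: s => [|z s IHs] s0.
  exists 1 => //; by rewrite /evalF rmorph1 oner_eq0.
have [z' z's|H H0 HP] := IHs; first by apply: s0; rewrite inE z's orbT.
have [a [b [b0 zE]]] : gen_field iota xi z by rewrite gen.
have a0 : ev a != 0.
  by apply: contraNneq (s0 z (mem_head _ _)) => a0; rewrite zE a0 mul0r.
exists (H * (a * b)) => [|c cP]; first by rewrite !evalFM !mulf_neq0.
rewrite !mevalM !mulf_eq0 !negb_or => /and3P [cH ca cb] z'.
rewrite inE => /predU1P [->|]; last exact: HP.
by exists (meval c a / meval c b); rewrite ?mulf_neq0 ?invr_eq0 //; exists a, b.
Qed.

Section Expansion.
Variables (y : 'I_m -> R) (s : {rmorphism F -> L}) (tau : F).
Hypothesis sE : forall f, s (ev f) = (mmap (@psC K) y f)%:F.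
Hypothesis s_tau : s tau = t%:F.

Lemma expansion_cst : s \o iota =1 lcst.
Proof. by move=> a; rewrite /= -(evalFC iota xi) sE mmap_polyC. Qed.

Lemma expansion_xi j : s (xi j) = (y j)%:F.
Proof. by rewrite -(evalFXU iota xi) sE mmapXU. Qed.

Lemma expansion_mmap2 x j q :
  s (mmap iota (point2 x (xi j)) q) = mmap lcst (point2 (s x) (y j)%:F) q.
Proof.
rewrite rmorph_mmap; apply: eq_mmap; first exact: expansion_cst.
by move=> k; rewrite point2_comp expansion_xi.
Qed.

Lemma expansion_eq0 f : (mmap (@psC K) y f == 0) = (ev f == 0).
Proof. by rewrite -tofrac_eq0 -sE fmorph_eq0. Qed.

Lemma expansion_algebraic j : algebraic_series (y j).
Proof.
have [q [q0 qE]] := algdep_all gen dim1 tau (xi j).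
by exists q; split=> //; rewrite -s_tau -expansion_mmap2 qE rmorph0.
Qed.

End Expansion.

Variables (n : nat) (phi : 'I_n -> F) (k : 'I_n) (p : 'I_m -> {mpoly K[2]}).
Hypothesis p0 : forall j, mmap iota (point2 (phi k) (xi j)) (p j) = 0.
Hypothesis p'0 : forall j,
  mmap iota (point2 (phi k) (xi j)) (mderiv ord_max (p j)) != 0.

(* All phi_l are defined at c, phi_k has value e there, and phi_k is etale at
   c because the p_j have simple roots. *)
Definition good_point c e :=
  [/\ specializes c, forall l, regular c (phi l), residue c (phi k) e &
      forall j, exists2 b, b != 0 &
        residue c (mmap iota (point2 (phi k) (xi j)) (mderiv ord_max (p j))) b].

Lemma good_point_open : exists2 H, ev H != 0 &
  forall c, specializes c -> meval c H != 0 -> exists e, good_point c e.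
Proof.
pose d j := mmap iota (point2 (phi k) (xi j)) (mderiv ord_max (p j)).
(* Vanishing phi_l are filtered out, as they have no nonzero residue; they are regular as
   constants. *)
have [z|H H0 HP] := @nonzero_residues
    ([seq z <- [seq phi l | l : 'I_n] | z != 0] ++ [seq d j | j : 'I_m]).
  rewrite mem_cat mem_filter => /orP [/andP [] //|/mapP [j _ ->]]; exact: p'0.
exists H => // c cP cH.
have phi_reg l : regular c (phi l).
  have [->|l0] := eqVneq (phi l) 0; first by rewrite -(rmorph0 iota);
    apply: regularC.
  have [|b _ lb] := HP _ cP cH (phi l); last by exists b.
  by rewrite mem_cat mem_filter l0 map_f ?mem_enum.
have [e ke] := phi_reg k; exists e; split=> // j.
apply: (HP _ cP cH); rewrite mem_cat; apply/orP; right.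
by apply/mapP; exists j; rewrite ?mem_enum.
Qed.

Lemma exists_good_point c0 tau :
  specializes c0 -> residue c0 tau 0 ->
  (forall j, exists2 u, regular c0 u & xi j - iota (c0 j) = tau * u) ->
  exists c e, good_point c e.
Proof.
move=> c0P tau_res xi_tau.
have tau0 := uniformizer_neq0 (exists_transc dim1) gen xi_tau.
have [y [s [sE s_tau _]]] := local_expansion c0P tau0 tau_res xi_tau gen
  (algdep_all gen dim1 tau).
have [H H0 HP] := good_point_open.
have [||c cP cH] := ample_specialization (h := H) K_ample (y := y).
- exact: expansion_algebraic sE s_tau.
- by rewrite (expansion_eq0 sE).
exists c; apply: HP => // f f0; apply: cP; apply/eqP.
by rewrite (expansion_eq0 sE) f0.
Qed.

(** Scaling turns a relation between t and y into one between a t and the scaled y, and a t is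
    algebraic over K(t). *)
Lemma algebraic_series_scale a (y : R) : a != 0 ->
  algebraic_series y -> algebraic_series (ps_scale a y).
Proof.
move=> a0 yalg; have tT := @transc_psX K.
have scale2 q (x z : R) : ps_scale a (ev2 (@psC K) x z q) =
    ev2 (@psC K) (ps_scale a x) (ps_scale a z) q.
  by apply: rmorph_ev2 => b; apply: ps_scaleC.
have atT : transc lcst (ps_scale a t)%:F.
  move=> q; rewrite ev1_tofrac => /eqP; rewrite tofrac_eq0.
  have -> : ev1 (@psC K) (ps_scale a t) q = ps_scale a (ps_of_poly q).
    by rewrite -ev1_psX -(ev2C _ _ 0) -[X in ev2 _ _ X](rmorph0 (ps_scale a))
      -scale2 ev2C.
  rewrite -(rmorph0 (ps_scale a)) => /eqP /(ps_scale_inj a0).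
  by rewrite -(rmorph0 (@ps_of_poly K)) => /ps_of_poly_inj.
apply: (algdep_exchange atT).
  apply: algdep_sym; rewrite ps_scaleX rmorphM; apply: algdep_mul => //.
    exact: (algdep_const _ tT).
  exact: algdep_refl.
have /algdepP [q [q0 qy]] := yalg; apply/algdepP; exists q; split=> //.
rewrite ev2_tofrac -scale2; move: qy; rewrite ev2_tofrac => /eqP.
by rewrite tofrac_eq0 => /eqP ->; rewrite !rmorph0.
Qed.

(** Expanding in the uniformizer phi_k - e sends phi_k to e + t. The copies of this expansion at a_l
    t are specialized together with t itself; x is the value of t. *)
Lemma good_point_scaling c e r (a : 'I_r -> K) :
  good_point c e -> (forall l, a l != 0) ->
  exists2 x, x != 0 & forall l, exists c', good_point c' (e + a l * x).
Proof.
move=> [cP phi_reg phi_e p'c] a0.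
have xi_tau := etale_uniformizer cP phi_e p0 p'c.
have tau_res : residue c (phi k - iota e) 0.
  rewrite -(subrr e); apply: residueD => //; apply: residueN; exact: residueC.
have tau0 := uniformizer_neq0 (exists_transc dim1) gen xi_tau.
have [y [s [sE s_tau _]]] := local_expansion cP tau0 tau_res xi_tau gen
  (algdep_all gen dim1 _).
have [H H0 HP] := good_point_open.
(* One index for each coordinate of each copy, and [None] for t, shared by all copies. *)
pose I := option ('I_r * 'I_m)%type; pose N := #|{: I}|.
pose v (l : 'I_r) (j : 'I_m) : 'I_N := enum_rank (Some (l, j) : I).
pose v0 : 'I_N := enum_rank (None : I).
pose Y (b : 'I_N) : R :=
  if enum_val b is Some lj then ps_scale (a lj.1) (y lj.2) else t.
have Yv l j : Y (v l j) = ps_scale (a l) (y j) by rewrite /Y enum_rankK.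
have Yv0 : Y v0 = t by rewrite /Y enum_rankK.
have Yalg b : algebraic_series (Y b).
  rewrite /Y; case: (enum_val b) => [[l j]|]; last exact: algdep_refl.
  by apply: algebraic_series_scale => //; exact: expansion_algebraic sE s_tau j.
pose lq l := [tuple ('X_(v l j) : {mpoly K[N]}) | j < m].
have Yf l f : mmap (@psC K) Y (f \mPo lq l) = ps_scale (a l) (mmap (@psC K) y
  f).
  rewrite mmap_comp_mpoly (rmorph_mmap (ps_scale (a l)));
    apply: eq_mmap => [b|j] /=.
    by rewrite ps_scaleC.
  by rewrite tnth_mktuple mmapXU Yv.
(* The first factor makes x nonzero, the others keep every copy good. *)
pose h := 'X_v0 * \prod_l (H \mPo lq l).
have [||C0 CP] := ample_specialization K_ample (y := Y) (h := h) => //.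
  rewrite /h rmorphM /= mmapXU Yv0 mulf_neq0 //.
    by apply/eqP => t0; have := ps_derivX K;
      rewrite t0 -(rmorph0 (@psC K)) ps_derivC
      => /esym/eqP; rewrite oner_eq0.
  rewrite rmorph_prod /=; apply/prodf_neq0 => l _; rewrite Yf.
  rewrite -(rmorph0 (ps_scale (a l))) (inj_eq (ps_scale_inj (a0 l))).
  by rewrite (expansion_eq0 sE).
rewrite mevalM mulf_eq0 negb_or mevalXU rmorph_prod /= => /andP [x0 /prodf_neq0
  HC].
exists (C0 v0) => // l; pose c' j := C0 (v l j).
have c'E f : meval C0 (f \mPo lq l) = meval c' f.
  rewrite comp_mpoly_meval; apply: meval_eq => j.
  by rewrite tnth_mktuple mevalXU.
have c'P : specializes c'.
  move=> f f0; rewrite -c'E; apply: CP; rewrite Yf.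
  have /eqP -> : mmap (@psC K) y f == 0 by rewrite (expansion_eq0 sE) f0.
  exact: rmorph0.
have [|e' gc'] := HP c' c'P; first by rewrite -c'E HC.
exists c'; suff <- : e' = e + a l * C0 v0 by [].
have [_ _ [f [g [g0 phiE ->]]] _] := gc'.
have gF := evalF_neq0 c'P g0.
have fg : mmap (@psC K) y f = (psC e + t) * mmap (@psC K) y g.
  apply/eqP; rewrite -tofrac_eq tofracM -!sE; apply/eqP.
  have -> : (psC e + t)%:F = s (phi k).
    by rewrite tofracD -s_tau -[(psC e)%:F](expansion_cst sE) /= -rmorphD addrC
      subrK.
  by rewrite -rmorphM phiE divfK.
have rel : mmap (@psC K) Y (f \mPo lq l - (e%:MP + (a l)%:MP * 'X_v0) * (g \mPo
  lq l)) = 0.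
  rewrite rmorphB rmorphM rmorphD rmorphM /= !mmap_polyC mmapXU Yv0 !Yf fg.
  by rewrite rmorphM rmorphD /= ps_scaleC ps_scaleX subrr.
have := CP _ rel; rewrite mevalB mevalM mevalD mevalM !mevalC mevalXU !c'E =>
  /eqP.
by rewrite subr_eq0 => /eqP ->; rewrite mulfK.
Qed.

End GoodPoints.

(** * Squares of infinite sets *)

Local Open Scope card_scope.

(* [R] need not be functional: being left-total on [A], with values in [B], and
   injective is enough to extract an injection by choice. *)
Definition injects (T U : Type) (A : set T) (B : set U) :=
  exists R : T -> U -> Prop,
    (forall x, A x -> exists2 y, B y & R x y) /\
    (forall x x' y, R x y -> R x' y -> x = x').

Lemma injects_fun (T U : Type) (A : set T) (B : set U) (f : T -> U) :
  (forall x, A x -> B (f x)) -> (forall x x', A x -> A x' -> f x = f x' -> x =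
    x') ->
  injects A B.
Proof.
move=> fB f_inj; exists (fun x y => A x /\ y = f x);
  split=> [x Ax|x x' _ [Ax ->] [Ax' E]].
  by exists (f x); [apply: fB|].
exact: f_inj.
Qed.

Lemma injects_choice (T U : Type) (A : set T) (B : set U) (y0 : U) :
  injects A B -> exists f : T -> U,
    (forall x, A x -> B (f x)) /\ (forall x x', A x -> A x' -> f x = f x' -> x =
      x').
Proof.
move=> [R [RB R_inj]].
have /choice [f fP] : forall x, exists y, A x -> B y /\ R x y.
  move=> x; have [/RB [y By Rxy]|nAx] := pselect (A x); first by exists y.
  by exists y0.
exists f; split=> [x /fP [] //|x x' /fP [_ Rx] /fP [_ Rx'] E].
by apply: R_inj Rx _; rewrite E.
Qed.

Lemma injects_trans (T U V : Type) (A : set T) (B : set U) (C : set V) :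
  injects A B -> injects B C -> injects A C.
Proof.
move=> [R [RB R_inj]] [S [SC S_inj]].
exists (fun x z => exists2 y, R x y & S y z); split=> [x /RB [y By xy]|].
  by have [z Cz yz] := SC _ By; exists z => //; exists y.
move=> x x' z [y xy yz] [y' x'y' y'z]; rewrite (S_inj _ _ _ yz y'z) in xy.
exact: R_inj xy x'y'.
Qed.

Lemma injects_card_le (T U : Type) (A : set T) (B : set U) :
  injects A B -> A #<= B.
Proof.
move=> AB; have [->|/set0P [x Ax]] := eqVneq A set0; first exact: card_ge0.
have [R [RB _]] := AB; have [y0 _ _] := RB _ Ax.
have [f [fB f_inj]] := injects_choice y0 AB.
have fA : f @` A #= A.
  by apply: inj_card_eq => u v; rewrite !in_setE; apply: f_inj.
rewrite -(card_le_eql fA); apply: subset_card_le => _ [x' Ax' <-]; exact: fB.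
Qed.

(** By Zorn there is a maximal partial injection; it is total on one side, since otherwise a further
    pair could be adjoined. *)
Lemma injects_total (T U : Type) (A : set T) (B : set U) :
  injects A B \/ injects B A.
Proof.
pose P (G : set (T * U)) := [/\ forall x y, G (x, y) -> A x /\ B y,
  forall x y y', G (x, y) -> G (x, y') -> y = y' &
  forall x x' y, G (x, y) -> G (x', y) -> x = x'].
have [F FP Ftot|G [[GAB Gfun Ginj] Gmax]] := @Zorn_bigcup _ P.
  have two a b : (\bigcup_(X in F) X) a -> (\bigcup_(X in F) X) b ->
      exists2 X, F X & X a /\ X b.
    move=> [X FX Xa] [Y FY Yb]; have [XY|YX] := Ftot _ _ FX FY.
      by exists Y => //; split=> //; apply: XY.
    by exists X => //; split=> //; apply: YX.
  split=> [x y [X /FP [XAB _ _]]|x y y' xy xy'|x x' y xy xy']; first exact: XAB.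
    by have [X /FP [_ Xf _] []] := two _ _ xy xy'; apply: Xf.
  by have [X /FP [_ _ Xi] []] := two _ _ xy xy'; apply: Xi.
have [Adom|/existsNP [x0 /not_implyP [Ax0 x0G]]] :=
    pselect (forall x, A x -> exists y, G (x, y)).
  left; exists (fun x y => G (x, y)); split=> // x /Adom [y xy].
  by exists y => //; have [] := GAB _ _ xy.
have [Bran|/existsNP [y0 /not_implyP [By0 y0G]]] :=
    pselect (forall y, B y -> exists x, G (x, y)).
  right; exists (fun y x => G (x, y)); split=> [y /Bran [x xy]|y y' x];
    last exact: Gfun.
  by exists x => //; have [] := GAB _ _ xy.
exfalso; apply: (Gmax (G `|` [set (x0, y0)])).
  split; first exact: subsetUl.
  by move=> /(_ (x0, y0) (or_intror erefl)) G0; apply: x0G; exists y0.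
split=> [x y [/GAB //|[-> ->] //]|x y y'|x x' y].
- move=> [xy|[xE yE]] [xy'|[xE' yE']]; subst; do ?by [].
  + exact: Gfun xy xy'.
  + by case: x0G; exists y.
  + by case: x0G; exists y'.
- move=> [xy|[xE yE]] [xy'|[xE' yE']]; subst; do ?by [].
  + exact: Ginj xy xy'.
  + by case: y0G; exists x.
  + by case: y0G; exists x'.
Qed.

Lemma infinite_injection (T : Type) (A : set T) : infinite_set A ->
  exists f : nat -> T, injective f /\ forall n, A (f n).
Proof.
move=> /infiniteP /card_leP [h].
exists (fun n => val (h (to_setT n))); split=> [a b /val_inj E|n]; last first.
  by have := valP (h (to_setT n)); rewrite in_setE.
have /(congr1 val) // : to_setT a = to_setT b.
by apply: (@inj _ _ _ h) => //; rewrite in_setE.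
Qed.

Section Square.
Variables (T : Type) (A : set T).

Definition diagonal (G : set (T * T * T)) b := exists c, G (b, b, c).

(** The graph of an injection of B x B into B for some subset B of [A]. B is recovered from the
    graph as [diagonal G], so that Zorn's lemma applies to plain sets of triples. *)
Definition pairing (G : set (T * T * T)) :=
  [/\ forall x c c', G (x, c) -> G (x, c') -> c = c',
      forall x x' c, G (x, c) -> G (x', c) -> x = x',
      forall b b', diagonal G b -> diagonal G b' -> exists c, G (b, b', c) &
      forall b b' c, G (b, b', c) ->
        [/\ diagonal G b, diagonal G b', diagonal G c & [/\ A b, A b' & A c]]].

Lemma maximal_pairing (f : nat -> T) : injective f -> (forall n, A (f n)) ->
  exists G, [/\ pairing G, forall n, diagonal G (f n) &
    forall G', pairing G' -> G `<=` G' -> G' `<=` G].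
Proof.
move=> f_inj fA.
(* The pairing of natural numbers by [pickle], transported along [f]. *)
pose G0 : set (T * T * T) := [set x | exists a b, x = (f a, f b, f (pickle (a,
  b)))].
have G0P : pairing G0.
  split.
  - move=> x c c' [a [b [-> ->]]] [a' [b' [/f_inj -> /f_inj -> ->]]] //.
  - move=> x x' c [a [b [-> ->]]] [a' [b' [-> /f_inj /(pcan_inj pickleK) [->
    ->]]]] //.
  - move=> _ _ [_ [a [_ [-> _ _]]]] [_ [b [_ [-> _ _]]]].
    by exists (f (pickle (a, b))), a, b.
  - move=> b b' c [a [a' [-> -> ->]]].
    have dG0 e : diagonal G0 (f e) by exists (f (pickle (e, e))), e, e.
    by split.
(* Adjoining [G0] settles the empty chain and keeps the sequence [f] inside the domain of the
   maximal pairing. *)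
have [F FP Ftot|H [HP Hmax]] := @Zorn_bigcup _ [set H | pairing (H `|` G0)].
  have [->|/set0P [H0 FH0]] := eqVneq F set0;
    first by rewrite bigcup_set0 /= set0U.
  set U := \bigcup_(X in F) X.
  have two x y : (U `|` G0) x -> (U `|` G0) y ->
      exists2 H, F H & (H `|` G0) x /\ (H `|` G0) y.
    move=> [[X FX Xx]|Gx] [[Y FY Yy]|Gy].
    - have [XY|YX] := Ftot _ _ FX FY.
        by exists Y => //; split; left=> //; apply: XY.
      by exists X => //; split; left=> //; apply: YX.
    - by exists X => //; split; [left | right].
    - by exists Y => //; split; [right | left].
    - by exists H0 => //; split; right.
  have up H : F H -> (H `|` G0) `<=` (U `|` G0).
    by move=> FH x [Hx|]; [left; exists H | right].
  split.
  - move=> x c c' xc xc'; have [H /FP [Hf _ _ _] []] := two _ _ xc xc'.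
    exact: Hf.
  - move=> x x' c xc x'c; have [H /FP [_ Hi _ _] []] := two _ _ xc x'c.
    exact: Hi.
  - move=> b b' [c bc] [c' b'c']; have [H FH [Hb Hb']] := two _ _ bc b'c'.
    have [_ _ Ht _] := FP _ FH.
    have [] := Ht b b'; [by exists c | by exists c' |].
    by move=> d dP; exists d; apply: up FH _ dP.
  - move=> b b' c bc; have [H FH [Hb _]] := two _ _ bc bc.
    have [_ _ _ Hs] := FP _ FH.
    have [[d bd] [d' b'd'] [d'' cd''] AAA] := Hs _ _ _ Hb.
    by split=> //; [exists d | exists d' | exists d'']; apply: up FH _ _.
exists (H `|` G0); split=> // [n|G' G'P sub].
  by exists (f (pickle (n, n))); right; exists n, n.
apply: contrapT => G'H; apply: (Hmax G').
  split; first by apply: subset_trans sub; exact: subsetUl.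
  by move=> H1; apply: G'H; apply: subset_trans H1 _; exact: subsetUl.
by rewrite /= setUidl //; apply: subset_trans sub; exact: subsetUr.
Qed.

(** Let B be the domain of a maximal pairing. If the complement of B injects into B, so does [A],
    and the pairing of B finishes. Otherwise B has a disjoint copy h(B) in [A], and the pairing
    extends to the union of both, against maximality. *)
Lemma infinite_square : infinite_set A -> injects (A `*` A) A.
Proof.
move=> /infinite_injection [f [f_inj fA]].
have [G [[Gfun Ginj Gtot Gsup] fG Gmax]] := maximal_pairing f_inj fA.
pose B := diagonal G.
have BA b : B b -> A b by move=> [c /Gsup [_ _ _ []]].
pose b0 := f 0%N; pose b1 := f 1%N.
have Bb0 : B b0 by apply: fG.
have Bb1 : B b1 by apply: fG.
have b01 : b0 <> b1 by move=> /f_inj.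
have /choice [g gP] : forall x : T * T, exists c, B x.1 -> B x.2 -> G (x, c).
  move=> [b b']; have [[Bb Bb']|nB] := pselect (B b /\ B b').
    by have [c bc] := Gtot _ _ Bb Bb'; exists c.
  by exists b0 => Bb Bb'; case: nB.
have gB b b' : B b -> B b' -> B (g (b, b')).
  by move=> Bb Bb'; have [] := Gsup _ _ _ (gP (b, b') Bb Bb').
have g_inj b b' d d' : B b -> B b' -> B d -> B d' ->
    g (b, b') = g (d, d') -> b = d /\ b' = d'.
  move=> Bb Bb' Bd Bd' E; have Gb := gP (b, b') Bb Bb'.
  by rewrite E in Gb; have [] := Ginj _ _ _ Gb (gP (d, d') Bd Bd').
(* Two copies of [B] embed in [B], hence so does [B] extended by any set which
   injects into [B]. *)
have ext (C : set T) (r : T -> T) : (forall x, C x -> ~ B x -> B (r x)) ->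
    (forall x x', C x -> C x' -> ~ B x -> ~ B x' -> r x = r x' -> x = x') ->
    exists u, (forall x, C x -> B (u x)) /\
      (forall x x', C x -> C x' -> u x = u x' -> x = x').
  move=> rB r_inj.
  exists (fun x => if pselect (B x) then g (x, b0) else g (r x, b1)).
  split=> [x Cx|x x' Cx Cx'].
    by case: pselect => Bx; apply: gB => //; apply: rB.
  case: pselect => Bx; case: pselect => Bx' /g_inj [] //.
  - exact: rB.
  - exact: rB.
  - by move=> _ /esym.
  - exact: rB.
  - exact: rB.
  - by move=> E _; apply: r_inj.
have [/(injects_choice b0) [r [rB r_inj]]|/(injects_choice b0) [h [hB h_inj]]]
  :=
    injects_total (A `\` B) B.
  have [||u [uB u_inj]] := ext A r.
  - by move=> x Ax Bx; apply: rB.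
  - by move=> x x' Ax Ax' Bx Bx'; apply: r_inj.
  apply: (injects_fun (f := fun x => g (u x.1, u x.2))) => [[x y] [Ax Ay]|].
    by apply: BA; apply: gB; apply: uB.
  move=> [x y] [x' y'] [/= Ax Ay] [/= Ax' Ay'] /g_inj [] //; try exact: uB.
  by move=> /u_inj -> // /u_inj ->.
exfalso.
have /choice [r rP] : forall x, exists b, (exists2 b, B b & x = h b) -> B b /\ x
  = h b.
  move=> x; have [[b Bb xE]|nb] := pselect (exists2 b, B b & x = h b).
    by exists b.
  by exists b0.
pose C x := B x \/ exists2 b, B b & x = h b.
have [||u [uB u_inj]] := ext C r.
- by move=> x [//|/rP []].
- move=> x x' [//|/rP [_ xE]] [//|/rP [_ x'E]] _ _ E.
  by rewrite xE x'E E.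
(* The new pairs get their values in h(B), away from the values of [G], which lie in B. *)
pose G' := G `|` [set x | [/\ C x.1.1, C x.1.2, ~ (B x.1.1 /\ B x.1.2) &
  x.2 = h (g (u x.1.1, u x.1.2))]].
have hG' b : C b -> diagonal G' b.
  move=> Cb; have [[c bc]|nB] := pselect (B b); first by exists c; left.
  by exists (h (g (u b, u b))); right; split=> // -[].
have G'C b : diagonal G' b -> C b.
  by move=> [c [bc|[]]] //; left; exists c.
have guB x y : C x -> C y -> B (g (u x, u y)) by move=> *; apply: gB; apply: uB.
have hnB b : B b -> ~ B (h b) by move=> /hB [].
have CA b : C b -> A b.
  by move=> [/BA //|[b' /hB [Ab _] ->]].
have G'G : G' `<=` G.
  apply: Gmax; last exact: subsetUl.
  split.
  - move=> [x y] c c' [xc|[/= Cx Cy nB cE]] [xc'|[/= Cx' Cy' nB' cE']].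
    + exact: Gfun xc xc'.
    + by case: nB'; have [] := Gsup _ _ _ xc.
    + by case: nB; have [] := Gsup _ _ _ xc'.
    + by rewrite cE cE'.
  - move=> [x y] [x' y'] c [xc|[/= Cx Cy nB cE]] [xc'|[/= Cx' Cy' nB' cE']].
    + exact: Ginj xc xc'.
    + have [_ _ Bc _] := Gsup _ _ _ xc.
      by exfalso; apply: (hnB _ (guB _ _ Cx' Cy')); rewrite -cE'.
    + have [_ _ Bc _] := Gsup _ _ _ xc'.
      by exfalso; apply: (hnB _ (guB _ _ Cx Cy)); rewrite -cE.
    + have := h_inj _ _ (guB _ _ Cx Cy) (guB _ _ Cx' Cy').
      rewrite -cE -cE' => /(_ erefl) /g_inj [] //; try exact: uB.
      by move=> /u_inj -> // /u_inj ->.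
  - move=> b b' /G'C Cb /G'C Cb'.
    have [[Bb Bb']|nB] := pselect (B b /\ B b').
      by have [c bc] := Gtot _ _ Bb Bb'; exists c; left.
    by exists (h (g (u b, u b'))); right.
  - move=> b b' c [bc|[/= Cb Cb' _ ->]].
      have [Bb Bb' Bc AAA] := Gsup _ _ _ bc.
      by split=> //; apply: hG'; left.
    have Ch : C (h (g (u b, u b'))) by right; exists (g (u b, u b')) => //;
      exact: guB.
    by split; try exact: hG'; split; exact: CA.
have Chb : C (h b0) by right; exists b0.
have [c /G'G hc] := hG' _ Chb.
by apply: (hnB b0) => //; exists c.
Qed.

End Square.

(** * The main theorem *)

Section GoodValues.
Variables (K : fieldType) (K_ample : ample K) (C : curve K).
Hypothesis C_simple : exists O, rat_points C O /\ smooth_at O.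
Variables (n : nat) (phi : 'I_n -> funfield C).
Hypothesis phi_separable : separable_map phi.

(* Separability over [K(phi)] together with a local expansion in K[[t]] singles
   out a coordinate [phi k] over which [K(C)] is already separable, namely one
   whose expansion has a nonzero derivative. *)
Lemma good_values : exists (k : 'I_n) (V : set K),
  [/\ V !=set0,
      forall e, V e -> forall r (a : 'I_r -> K), (forall l, a l != 0) ->
        exists2 x, x != 0 & forall l, V (e + a l * x) &
      forall e, V e -> exists2 Y, rat_image phi Y & Y 0 k = e].
Proof.
have [O [[_ Oval] [i [P [PP OE [f [g [fI detJ]]]]]]]] := C_simple.
have [|c0 c0P PE] := rational_prime PP.
  by rewrite -OE => z /Oval [a [_ za]]; exists a.
rewrite PE in detJ.
have gen := coord_gen i.
have [_ _ _ dim1] := chart_affine_curve i.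
have [l0 xi_tau] := jacobian_uniformizer gen dim1 c0P fI detJ.
pose tau := coord l0 - cst C (c0 l0).
have tau_res : residue (cst C) (@coord K C i) c0 tau 0.
  rewrite -(subrr (c0 l0)); apply: residueD => //; last first.
    by apply: residueN; apply: residueC.
  by have := residue_evalF (cst C) (@coord K C i) c0 'X_l0;
    rewrite evalFXU mevalXU.
have tau0 := uniformizer_neq0 (exists_transc dim1) gen xi_tau.
have [y [s [sE s_tau _]]] := local_expansion c0P tau0 tau_res xi_tau gen
  (algdep_all gen dim1 tau).
have s_cst := expansion_cst sE.
(* If all phi_k had derivative zero, so would every element of K(phi); differentiating the separable
   equation of [tau], whose image is t, would make the derivative of that equation vanish at
   [tau]. *)
have [k k0] : exists k, fr_deriv (s (phi k)) != 0.
  apply: contrapT => /forallNP nok.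
  have phi0 k : fr_deriv (s (phi k)) = 0 by apply/eqP/negP => /negP/(nok k).
  have [p [pk psep proot]] := phi_separable tau.
  have := separable_root_deriv psep proot.
  rewrite -(fmorph_eq0 s) -horner_map -deriv_map /= s_tau => p'0.
  have := @fr_deriv_horner K (map_poly s p) (@FracField.tofrac _ (psX K)).
  rewrite fr_derivF ps_derivX tofrac1 mulr1 -[X in fr_deriv _.[X]]s_tau.
  rewrite horner_map (rootP proot) rmorph0 -(rmorph0 (@lcst K)) fr_derivC => H.
  case/eqP: p'0; rewrite -H ?rmorph0 // => l.
  by rewrite coef_map; apply: fr_deriv_gen_field s_cst phi0 (pk l).
(* Here [s (phi k)] plays the role of t: its derivative is nonzero, so each coordinate satisfies a
   separable relation over K(phi_k). *)
have /choice [p pP] : forall j, exists p : {mpoly K[2]},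
    mmap (cst C) (point2 (phi k) (@coord K C i j)) p = 0 /\
    mmap (cst C) (point2 (phi k) (@coord K C i j)) (mderiv ord_max p) != 0.
  move=> j; have [q [q0 qE]] := algdep_all gen dim1 (phi k) (@coord K C i j).
  have [|r [r0 r'0]] := @separating_relation K
      (point2 (s (phi k)) (@FracField.tofrac _ (y j))) q k0 q0.
    by rewrite -(expansion_mmap2 sE) qE rmorph0.
  exists r; rewrite -(fmorph_eq0 s) (expansion_mmap2 sE) r'0; split=> //.
  by apply/eqP; rewrite -(fmorph_eq0 s) (expansion_mmap2 sE) r0.
have p0 j := (pP j).1; have p'0 j := (pP j).2.
pose V e := exists c, good_point (cst C) (@coord K C i) phi k p c e.
exists k, V; split.
- have [c [e ce]] := exists_good_point K_ample gen dim1 p'0 c0P tau_res xi_tau.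
  by exists e, c.
- move=> e [c ce] r a a0.
  have [x x0 xP] := good_point_scaling K_ample gen dim1 p0 p'0 ce a0.
  by exists x.
move=> e [c [cP phi_reg phi_e _]].
have /choice [v vP] := phi_reg.
exists (\row_l v l); last by rewrite mxE; apply: (residue_inj cP (vP k)).
exists (curve_point c); split; first exact: curve_point_rational.
by move=> l; rewrite mxE; apply: residue_has_value.
Qed.

Section Subfield.
Variable K0 : {pred K}.
Hypothesis K0_subfield : GRing.divring_closed K0.
Hypothesis K0_proper : exists x : K, x \notin K0.
Local Notation T := (rat_image phi `\` affine_points K0 n).

(* A scalar [u] which moves two of the elements 1, c, 1 + c into [K0] would put
   [c] itself in [K0]. *)
Lemma three_multipliers c u : c \notin K0 -> u != 0 ->
  [\/ u \notin K0 /\ c * u \notin K0,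
      u \notin K0 /\ (1 + c) * u \notin K0 |
      c * u \notin K0 /\ (1 + c) * u \notin K0].
Proof.
have [K1 Ksub Kdiv] := K0_subfield => cK u0.
have Kdiv1 x : x * u \in K0 -> u \in K0 -> x \in K0.
  by move=> xu uK; have := Kdiv _ _ xu uK; rewrite mulfK.
have Ksub1 x : 1 + x \in K0 -> x \in K0.
  by move=> xK; have := Ksub _ _ xK K1; rewrite addrC addKr.
have [uK|uK] := boolP (u \in K0).
  constructor 3; split; apply: contra cK => /Kdiv1 H; first exact: H.
  by apply: Ksub1; apply: H.
have [cuK|cuK] := boolP (c * u \in K0); last by constructor 1.
constructor 2; split=> //; apply: contra uK => K1c.
by have := Ksub _ _ K1c cuK; rewrite mulrDl mul1r addrK.
Qed.

Lemma quotients_of_outer_values : exists (k : 'I_n) (e : K), forall a, a != 0 ->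
  exists Y Y', [/\ T Y, T Y', Y 0 k - e != 0 & a = (Y' 0 k - e) / (Y 0 k - e)].
Proof.
have [k [V [[e Ve] Vscale Vim]]] := good_values.
have [c cK] := K0_proper; have [K1 Ksub Kdiv] := K0_subfield.
have TV z : V z -> z \notin K0 -> exists2 Y, T Y & Y 0 k = z.
  move=> Vz zK; have [Y Yim Yk] := Vim z Vz; exists Y => //; split=> //.
  by move=> /(_ k); rewrite Yk (negPf zK).
have pair z d a x : a != 0 -> d != 0 -> x != 0 ->
    V (z + d * x) -> V (z + d * a * x) ->
    z + d * x \notin K0 -> z + d * a * x \notin K0 ->
    exists Y Y', [/\ T Y, T Y', Y 0 k - z != 0 & a = (Y' 0 k - z) / (Y 0 k -
      z)].
  move=> a0 d0 x0 V1 V2 /(TV _ V1) [Y TY Yk] /(TV _ V2) [Y' TY' Y'k].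
  exists Y, Y'; rewrite Yk Y'k ![z + _]addrC !addrK mulf_neq0 //; split=> //.
  by field; rewrite x0 d0.
(* If no element of [V] lies in [K0], the multipliers 1 and a suffice; otherwise the base value is
   taken in [K0], so that adding it does not affect membership. *)
have [[z Vz zK]|noV] := pselect (exists2 z, V z & z \in K0); last first.
  exists k, e => a a0.
  have [l|x x0 Vx] := Vscale e Ve 2 (point2 1 a).
    by rewrite /point2; case: ifP; rewrite ?oner_eq0.
  have nK w : V w -> w \notin K0 by move=> Vw; apply/negP => wK; apply: noV;
    exists w.
  have V1 := Vx ord0; have V2 := Vx ord_max; rewrite /point2 /= in V1 V2.
  by apply: (pair e 1 a x) => //; rewrite ?oner_eq0 ?mul1r ?nK //;
    rewrite mul1r in V1.
exists k, z => a a0.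
have c0 : c != 0 by apply: contraNneq cK => ->; rewrite -(subrr 1); apply: Ksub.
have c10 : 1 + c != 0.
  apply: contraNneq cK => /eqP; rewrite addrC addr_eq0 => /eqP ->.
  by rewrite -[- 1]add0r -(subrr 1); do 2!apply: (Ksub) => //.
pose d : 'I_3 -> K := fun l => nth 1 [:: 1; c; 1 + c] l.
have d0 l : d l != 0 by rewrite /d; case: l => [[|[|[|l]]] //= _];
  rewrite ?oner_eq0.
(* All six multipliers d and d a are treated at once, so that a single x serves them. *)
pose A (l : 'I_3 * bool) := if l.2 then d l.1 * a else d l.1.
have [l|x x0 Vx] := Vscale z Vz #|{: 'I_3 * bool}| (A \o enum_val).
  by rewrite /A /=; case: ifP => _; rewrite ?mulf_neq0.
have V1 l : V (z + d l * x).
  by have := Vx (enum_rank (l, false)); rewrite /= enum_rankK.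
have V2 l : V (z + d l * a * x).
  by have := Vx (enum_rank (l, true)); rewrite /= enum_rankK.
have zD w : w \notin K0 -> z + w \notin K0.
  by apply: contra => zw; have := Ksub _ _ zw zK; rewrite addrC addKr.
(* For x and for a x, at least two of the three multiples avoid [K0]; two such pairs of multipliers
   share one. *)
have [l [l1 l2]] : exists l, d l * x \notin K0 /\ d l * a * x \notin K0.
  have i0 : (0 < 3)%N by []. have i1 : (1 < 3)%N by []. have i2 : (2 < 3)%N by
    [].
  have D0 : d (Ordinal i0) = 1 by []. have D1 : d (Ordinal i1) = c by [].
  have D2 : d (Ordinal i2) = 1 + c by [].
  have ax0 : a * x != 0 by rewrite mulf_neq0.
  case: (three_multipliers cK x0) => -[x1 x2];
  case: (three_multipliers cK ax0) => -[y1 y2];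
  first [ by exists (Ordinal i0); rewrite D0 ?mul1r -?mulrA ?mul1r
        | by exists (Ordinal i1); rewrite D1 -?mulrA
        | by exists (Ordinal i2); rewrite D2 -?mulrA ].
by apply: (pair z (d l) a x) => //; apply: zD.
Qed.

End Subfield.
End GoodValues.

(** * Cardinality of the image *)

Lemma injects_setX (T U : Type) (A : set T) (B : set U) :
  injects A B -> injects (A `*` A) (B `*` B).
Proof.
move=> [R [RB R_inj]].
exists (fun x y => R x.1 y.1 /\ R x.2 y.2);
  split=> [[x x'] [/= /RB [y By xy] /RB [y' By' xy']]|].
  by exists (y, y').
move=> [x1 x2] [x1' x2'] [y1 y2] /= [h1 h2] [h1' h2'].
by rewrite (R_inj _ _ _ h1 h1') (R_inj _ _ _ h2 h2').
Qed.

Lemma injects_row (K : fieldType) n : infinite_set [set: K] ->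
  injects [set: 'rV[K]_n] [set: K].
Proof.
move=> Kinf; elim: n => [|n IHn].
  by apply: (injects_fun (f := fun=> 0)) => // x x' _ _ _; apply/rowP => -[].
have [r [_ r_inj]] := injects_choice 0 IHn.
apply: injects_trans (infinite_square Kinf).
apply: (injects_fun (f := fun x : 'rV[K]_n.+1 => (x 0 ord0, r (\row_i x 0 (lift
  ord0 i))))).
  by [].
move=> x x' _ _ [E0 /r_inj E]; apply/rowP => i.
have [i' ->|->] := unliftP ord0 i; last exact: E0.
by have /rowP /(_ i') := E I I; rewrite !mxE.
Qed.

Theorem theorem1 (K : fieldType) (K_ample : ample K)
    (C : curve K)
    (C_simple : exists O, rat_points C O /\ smooth_at O)
    (n : nat) (C' : {pred {mpoly K[n]}}) (C'_curve : affine_curve C')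
    (phi : 'I_n -> funfield C)
    (phi_into : maps_into phi C')
    (phi_dominant : dominant phi C')
    (phi_separable : separable_map phi)
    (K0 : {pred K}) (K0_subfield : GRing.divring_closed K0)
    (K0_proper : exists x : K, x \notin K0) :
  (rat_image phi `\` affine_points K0 n) #= [set: K].
Proof.
set T := _ `\` _.
have Kinf := ample_infinite K_ample.
(* [T] lies in K^n, which injects into the infinite field K; the rest injects K into [T]. *)
apply: Cantor_Bernstein.
  apply: card_le_trans (card_leT _) _; apply: injects_card_le.
  exact: injects_row Kinf.
have [k [e quot]] :=
  quotients_of_outer_values K_ample C_simple phi_separable K0_subfield
    K0_proper.
(* A pair of points determines its quotient, so relating a to the pairs with quotient a is
   injective. *)
have nz : injects [set a : K | a != 0] (T `*` T).
  exists (fun (a : K) (x : 'rV[K]_n * 'rV[K]_n) => x.1 0 k - e != 0 /\ a = (x.2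
    0 k - e) / (x.1 0 k - e)).
  split=> [a /quot [Y [Y' [TY TY' Y0 aE]]]|a a' x [_ ->] [_ ->] //].
  by exists (Y, Y').
have Tinf : infinite_set T.
  move=> Tfin; apply: Kinf.
  have := card_le_finite (injects_card_le nz) (finite_setX Tfin Tfin) => nzfin.
  apply: (@sub_finite_set _ _ ([set a : K | a != 0] `|` [set 0])).
    by move=> a _; have [->|a0] := eqVneq a 0; [right | left].
  by rewrite finite_setU; split.
have [f [f_inj fT]] := infinite_injection Tinf.
apply: injects_card_le.
(* [T] absorbs two squarings. The second factor of the square of T x T is a tag, built from [f 1]
   for a = 0 and from [f 0] for the nonzero elements handled by [nz]. *)
apply: injects_trans (infinite_square Tinf).
apply: injects_trans (injects_setX (infinite_square Tinf)).
have [R [RT R_inj]] := nz.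
exists (fun a x => (a != 0 /\ R a x.1 /\ x.2 = (f 0%N, f 0%N)) \/
                   (a = 0 /\ x.2 = (f 1%N, f 1%N))).
split=> [a _|a a' x].
  have [->|a0] := eqVneq a 0.
    by exists ((f 0%N, f 0%N), (f 1%N, f 1%N)); [split; split;
      exact: fT | right].
  by have [x Tx Rax] := RT a a0; exists (x, (f 0%N, f 0%N)); [split=> //;
    split; exact: fT | left].
move=> [[a0 [Ra ->]]|[-> ->]] [[a'0 [Ra' E]]|[-> E]] //.
- exact: R_inj Ra Ra'.
- by case: E => /f_inj.
- by case: E => /f_inj.
Qed.
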